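(* Let $K$ be an $R_1MF$-domain and let $\mathcal L^\circ$ be the category of finitely generated free Lie algebras over $K$. Then every automorphism of the category $\mathcal L^\circ$ is semi-inner.
   Context: All rings are commutative, associative, with $1$. A domain $K$ with quotient field $\tilde K$ is an $R_1MF$-domain if every $n\times m$ matrix over $K$ (any $n,m$) whose rank over $\tilde K$ equals $1$ is a product of an $n\times 1$ matrix over $K$ and a $1\times m$ matrix over $K$. $\mathcal L^\circ$ is the full subcategory of the category of Lie algebras over $K$ whose objects are the free Lie algebras $F(X)$, where $X$ runs over the finite subsets of a fixed infinite set $X^0$; it is a small category. An automorphism of a category is a functor to itself that is bijective on objects and on morphisms. For Lie algebras $A_1,A_2$ over $K$, a semi-isomorphism $A_1\to A_2$ is a pair $(\delta,f)$ with $\delta$ a ring automorphism of $K$ and $f:A_1\to A_2$ a ring isomorphism (bijective, preserving addition and multiplication) such that $f(\alpha u)=\alpha^{\delta}f(u)$ for all $\alpha\in K$, $u\in A_1$. An automorphism $\varphi$ of $\mathcal L^\circ$ is semi-inner if there are $\delta\in\mathrm{Aut}\,K$ and a family of semi-isomorphisms $s_{F(X)}=(\delta,f_{F(X)}):F(X)\to\varphi(F(X))$, one for each object $F(X)$, such that for every homomorphism $\nu:F(X)\to F(Y)$ one has $\varphi(\nu)\circ s_{F(X)}=s_{F(Y)}\circ\nu$. *)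

(* Defs.v *)
From HB Require Import structures.
From mathcomp Require Import all_boot all_order all_algebra.
From mathcomp Require Import finmap.
From mathcomp Require Import boolp classical_sets cardinality.

Set Implicit Arguments.
Unset Strict Implicit.
Unset Printing Implicit Defensive.

Import GRing.Theory.
Local Open Scope ring_scope.

Definition R1MF_domain (K : idomainType) : Prop :=
  forall (n m : nat) (A : 'M[K]_(n, m)),
    \rank (map_mx (@tofrac K) A) = 1%N ->
    exists (u : 'M[K]_(n, 1)) (v : 'M[K]_(1, m)), A = u *m v.

HB.mixin Record Lmodule_isLieAlgebra (K : comNzRingType) L
    of GRing.Lmodule K L := {
  lieb : L -> L -> L;
  liebDl : forall x y z, lieb (x + y) z = lieb x z + lieb y z;
  liebDr : forall x y z, lieb x (y + z) = lieb x y + lieb x z;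
  liebZl : forall (a : K) x y, lieb (a *: x) y = a *: lieb x y;
  liebZr : forall (a : K) x y, lieb x (a *: y) = a *: lieb x y;
  liebxx : forall x, lieb x x = 0;
  lieb_jacobi : forall x y z,
    lieb x (lieb y z) + lieb y (lieb z x) + lieb z (lieb x y) = 0
}.

#[short(type="lieAlgType")]
HB.structure Definition LieAlgebra (K : comNzRingType) :=
  {L of GRing.Lmodule K L & Lmodule_isLieAlgebra K L}.

Record lie_hom (K : comNzRingType) (A B : lieAlgType K) := LieHom {
  lie_fun :> A -> B;
  lie_funP : linear lie_fun;
  lie_funM : forall x y, lie_fun (lieb x y) = lieb (lie_fun x) (lie_fun y)
}.

HB.instance Definition _ (K : comNzRingType) (A B : lieAlgType K)
    (f : lie_hom A B) :=
  GRing.isLinear.Build K A B *:%R (lie_fun f) (lie_funP f).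

Lemma lie_hom_ext (K : comNzRingType) (A B : lieAlgType K)
  (f g : lie_hom A B) : f =1 g -> f = g.
Proof.
case: f g => [f f1 f2] [g g1 g2] /= /funext fg; subst g.
by rewrite (Prop_irrelevance f1 g1) (Prop_irrelevance f2 g2).
Qed.

Section LieHomComp.
Context (K : comNzRingType).

Definition lie_id (A : lieAlgType K) : lie_hom A A.
Proof. by exists idfun. Defined.

Definition lie_comp (A B C : lieAlgType K)
  (g : lie_hom B C) (f : lie_hom A B) : lie_hom A C.
Proof.
exists (g \o f) => [a x y|x y] /=; first by rewrite !linearP.
by rewrite !lie_funM.
Defined.

End LieHomComp.

Record category := Category {
  obj :> Type;
  hom : obj -> obj -> Type;
  idm : forall X, hom X X;
  comp : forall X Y Z, hom Y Z -> hom X Y -> hom X Z;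
  comp1m : forall X Y (f : hom X Y), comp (idm Y) f = f;
  compm1 : forall X Y (f : hom X Y), comp f (idm X) = f;
  compA : forall X Y Z T (h : hom Z T) (g : hom Y Z) (f : hom X Y),
    comp h (comp g f) = comp (comp h g) f
}.

Record functor (C D : category) := Functor {
  fobj :> C -> D;
  fmap : forall X Y : C, hom X Y -> hom (fobj X) (fobj Y);
  fmap1 : forall X : C, fmap (idm X) = idm (fobj X);
  fmap_comp : forall (X Y Z : C) (g : hom Y Z) (f : hom X Y),
    fmap (comp g f) = comp (fmap g) (fmap f)
}.

(* The collection of all morphisms of C, each with its source and target. *)
Definition arrow (C : category) : Type :=
  {XY : C * C & hom XY.1 XY.2}.

Definition farrow (C D : category) (F : functor C D) (a : arrow C) : arrow D :=
  existT (fun XY : D * D => hom XY.1 XY.2)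
    (F (tag a).1, F (tag a).2) (fmap F (tagged a)).

Definition category_automorphism (C : category) (F : functor C C) : Prop :=
  bijective (fobj F) /\ bijective (farrow F).

Definition full_subcategory (C : category) (I : Type) (F : I -> C) : category :=
  @Category I (fun i j => hom (F i) (F j)) (fun i => idm (F i))
    (fun i j k g f => comp g f)
    (fun i j f => comp1m f) (fun i j f => compm1 f)
    (fun i j k l h g f => compA h g f).

Section LieCategory.
Context (K : comNzRingType).

Lemma lie_comp1m (A B : lieAlgType K) (f : lie_hom A B) :
  lie_comp (lie_id B) f = f.
Proof. exact: lie_hom_ext. Qed.

Lemma lie_compm1 (A B : lieAlgType K) (f : lie_hom A B) :
  lie_comp f (lie_id A) = f.
Proof. exact: lie_hom_ext. Qed.

Lemma lie_compA (A B C D : lieAlgType K)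
    (h : lie_hom C D) (g : lie_hom B C) (f : lie_hom A B) :
  lie_comp h (lie_comp g f) = lie_comp (lie_comp h g) f.
Proof. exact: lie_hom_ext. Qed.

Definition lie_category : category :=
  Category lie_comp1m lie_compm1 lie_compA.

End LieCategory.

(* The free Lie algebra on X is the algebra of formal terms over X modulo the
   congruence generated by the K-module and Lie algebra identities. *)
Inductive lie_term (K X : Type) : Type :=
| TVar of X
| TZero
| TOpp of lie_term K X
| TAdd of lie_term K X & lie_term K X
| TScale of K & lie_term K X
| TBracket of lie_term K X & lie_term K X.

Arguments TVar {K X}.
Arguments TZero {K X}.

Inductive lie_cong (K : comNzRingType) (X : Type) :
    lie_term K X -> lie_term K X -> Prop :=
| LCrefl s : lie_cong s s
| LCsym s t : lie_cong s t -> lie_cong t s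
| LCtrans s t u : lie_cong s t -> lie_cong t u -> lie_cong s u
| LCopp s s' : lie_cong s s' -> lie_cong (TOpp s) (TOpp s')
| LCadd s s' t t' : lie_cong s s' -> lie_cong t t' ->
    lie_cong (TAdd s t) (TAdd s' t')
| LCscale a s s' : lie_cong s s' -> lie_cong (TScale a s) (TScale a s')
| LCbracket s s' t t' : lie_cong s s' -> lie_cong t t' ->
    lie_cong (TBracket s t) (TBracket s' t')
| LCaddA s t u : lie_cong (TAdd s (TAdd t u)) (TAdd (TAdd s t) u)
| LCaddC s t : lie_cong (TAdd s t) (TAdd t s)
| LCadd0 s : lie_cong (TAdd TZero s) s
| LCaddN s : lie_cong (TAdd (TOpp s) s) TZero
| LCscaleA a b s : lie_cong (TScale a (TScale b s)) (TScale (a * b) s)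
| LCscale1 s : lie_cong (TScale 1 s) s
| LCscaleDr a s t :
    lie_cong (TScale a (TAdd s t)) (TAdd (TScale a s) (TScale a t))
| LCscaleDl a b s :
    lie_cong (TScale (a + b) s) (TAdd (TScale a s) (TScale b s))
| LCbracketDl s t u :
    lie_cong (TBracket (TAdd s t) u) (TAdd (TBracket s u) (TBracket t u))
| LCbracketDr s t u :
    lie_cong (TBracket s (TAdd t u)) (TAdd (TBracket s t) (TBracket s u))
| LCbracketZl a s t :
    lie_cong (TBracket (TScale a s) t) (TScale a (TBracket s t))
| LCbracketZr a s t :
    lie_cong (TBracket s (TScale a t)) (TScale a (TBracket s t))
| LCbracketxx s : lie_cong (TBracket s s) TZero
| LCjacobi s t u :
    lie_cong (TAdd (TAdd (TBracket s (TBracket t u))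
                         (TBracket t (TBracket u s)))
                   (TBracket u (TBracket s t))) TZero.

HB.instance Definition _ (K X : Type) := gen_eqMixin (lie_term K X).
HB.instance Definition _ (K X : Type) := gen_choiceMixin (lie_term K X).

Section FreeLie.
Context (K : comNzRingType) (X : Type).
Local Notation term := (lie_term K X).
Local Open Scope quotient_scope.

Definition lie_congb (s t : term) : bool := `[< lie_cong s t >].

Lemma lie_congb_refl : reflexive lie_congb.
Proof. by move=> s; apply/asboolP/LCrefl. Qed.

Lemma lie_congb_sym : symmetric lie_congb.
Proof. by move=> s t; apply/asboolP/asboolP; apply: LCsym. Qed.

Lemma lie_congb_trans : transitive lie_congb.
Proof.
by move=> t s u /asboolP st /asboolP tu; apply/asboolP/(LCtrans st tu).
Qed.

Canonical lie_cong_equiv :=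
  EquivRel lie_congb lie_congb_refl lie_congb_sym lie_congb_trans.

Definition free_lie : Type := {eq_quot lie_cong_equiv}.
HB.instance Definition _ := Choice.on free_lie.
HB.instance Definition _ := Quotient.on free_lie.

Local Notation cl := (\pi_free_lie : term -> free_lie).

Lemma free_lie_eqP (s t : term) : cl s = cl t <-> lie_cong s t.
Proof.
by split=> [/eqmodP/asboolP|st] //; apply/eqmodP/asboolP.
Qed.

Lemma free_lie_repr (s : term) : lie_cong (repr (cl s)) s.
Proof. by apply/free_lie_eqP; rewrite reprK. Qed.

Definition free_lie_var (x : X) : free_lie := cl (TVar x).
Definition free_lie_zero : free_lie := cl TZero.
Definition free_lie_opp (u : free_lie) : free_lie := cl (TOpp (repr u)).
Definition free_lie_add (u v : free_lie) : free_lie :=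
  cl (TAdd (repr u) (repr v)).
Definition free_lie_scale (a : K) (u : free_lie) : free_lie :=
  cl (TScale a (repr u)).
Definition free_lie_bracket (u v : free_lie) : free_lie :=
  cl (TBracket (repr u) (repr v)).

Lemma free_lie_oppE s : free_lie_opp (cl s) = cl (TOpp s).
Proof. by apply/free_lie_eqP/LCopp/free_lie_repr. Qed.

Lemma free_lie_addE s t : free_lie_add (cl s) (cl t) = cl (TAdd s t).
Proof. by apply/free_lie_eqP/LCadd; apply: free_lie_repr. Qed.

Lemma free_lie_scaleE a s : free_lie_scale a (cl s) = cl (TScale a s).
Proof. by apply/free_lie_eqP/LCscale/free_lie_repr. Qed.

Lemma free_lie_bracketE s t :
  free_lie_bracket (cl s) (cl t) = cl (TBracket s t).
Proof. by apply/free_lie_eqP/LCbracket; apply: free_lie_repr. Qed.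

Lemma free_lie_addA : associative free_lie_add.
Proof.
elim/quotW=> s; elim/quotW=> t; elim/quotW=> u.
rewrite (free_lie_addE t u) (free_lie_addE s t) !free_lie_addE.
by apply/free_lie_eqP; exact: LCaddA.
Qed.

Lemma free_lie_addC : commutative free_lie_add.
Proof.
elim/quotW=> s; elim/quotW=> t.
by rewrite !free_lie_addE; apply/free_lie_eqP; exact: LCaddC.
Qed.

Lemma free_lie_add0 : left_id free_lie_zero free_lie_add.
Proof.
by elim/quotW=> s; rewrite free_lie_addE; apply/free_lie_eqP; exact: LCadd0.
Qed.

Lemma free_lie_addN : left_inverse free_lie_zero free_lie_opp free_lie_add.
Proof.
by elim/quotW=> s; rewrite free_lie_oppE free_lie_addE; apply/free_lie_eqP; exact: LCaddN.
Qed.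

HB.instance Definition _ := GRing.isZmodule.Build free_lie
  free_lie_addA free_lie_addC free_lie_add0 free_lie_addN.

Lemma free_lie_scaleA a b u :
  free_lie_scale a (free_lie_scale b u) = free_lie_scale (a * b) u.
Proof.
elim/quotW: u => s; rewrite (free_lie_scaleE b s) !free_lie_scaleE.
by apply/free_lie_eqP; exact: LCscaleA.
Qed.

Lemma free_lie_scale1 : left_id 1 free_lie_scale.
Proof. by elim/quotW=> s; rewrite free_lie_scaleE; apply/free_lie_eqP; exact: LCscale1. Qed.

Lemma free_lie_scaleDr : right_distributive free_lie_scale +%R.
Proof.
move=> a; elim/quotW=> s; elim/quotW=> t; rewrite /GRing.add /=.
rewrite (free_lie_addE s t) !free_lie_scaleE free_lie_addE.
by apply/free_lie_eqP; exact: LCscaleDr.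
Qed.

Lemma free_lie_scaleDl u : {morph free_lie_scale^~ u : a b / a + b}.
Proof.
move=> a b; elim/quotW: u => s; rewrite [RHS]/GRing.add /=.
rewrite !free_lie_scaleE free_lie_addE.
by apply/free_lie_eqP; exact: LCscaleDl.
Qed.

HB.instance Definition _ := GRing.Zmodule_isLmodule.Build K free_lie
  free_lie_scaleA free_lie_scale1 free_lie_scaleDr free_lie_scaleDl.

Lemma free_lie_piD s t : cl (TAdd s t) = cl s + cl t.
Proof. by rewrite -free_lie_addE. Qed.

Lemma free_lie_piN s : cl (TOpp s) = - cl s.
Proof. by rewrite -free_lie_oppE. Qed.

Lemma free_lie_piZ a s : cl (TScale a s) = a *: cl s.
Proof. by rewrite -free_lie_scaleE. Qed.

Lemma free_lie_bracketDl (x y z : free_lie) :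
  free_lie_bracket (x + y) z = free_lie_bracket x z + free_lie_bracket y z.
Proof.
elim/quotW: x => s; elim/quotW: y => t; elim/quotW: z => u.
rewrite -free_lie_piD !free_lie_bracketE -free_lie_piD.
apply/free_lie_eqP; exact: LCbracketDl.
Qed.

Lemma free_lie_bracketDr (x y z : free_lie) :
  free_lie_bracket x (y + z) = free_lie_bracket x y + free_lie_bracket x z.
Proof.
elim/quotW: x => s; elim/quotW: y => t; elim/quotW: z => u.
rewrite -free_lie_piD !free_lie_bracketE -free_lie_piD.
apply/free_lie_eqP; exact: LCbracketDr.
Qed.

Lemma free_lie_bracketZl (a : K) (x y : free_lie) :
  free_lie_bracket (a *: x) y = a *: free_lie_bracket x y.
Proof.
elim/quotW: x => s; elim/quotW: y => t.
rewrite -free_lie_piZ !free_lie_bracketE -free_lie_piZ.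
apply/free_lie_eqP; exact: LCbracketZl.
Qed.

Lemma free_lie_bracketZr (a : K) (x y : free_lie) :
  free_lie_bracket x (a *: y) = a *: free_lie_bracket x y.
Proof.
elim/quotW: x => s; elim/quotW: y => t.
rewrite -free_lie_piZ !free_lie_bracketE -free_lie_piZ.
apply/free_lie_eqP; exact: LCbracketZr.
Qed.

Lemma free_lie_bracketxx (x : free_lie) : free_lie_bracket x x = 0.
Proof.
by elim/quotW: x => s; rewrite free_lie_bracketE; apply/free_lie_eqP; exact: LCbracketxx.
Qed.

Lemma free_lie_jacobi (x y z : free_lie) :
  free_lie_bracket x (free_lie_bracket y z)
  + free_lie_bracket y (free_lie_bracket z x)
  + free_lie_bracket z (free_lie_bracket x y) = 0.
Proof.
elim/quotW: x => s; elim/quotW: y => t; elim/quotW: z => u.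
rewrite (free_lie_bracketE t u) (free_lie_bracketE u s) (free_lie_bracketE s t).
rewrite !free_lie_bracketE -!free_lie_piD.
apply/free_lie_eqP; exact: LCjacobi.
Qed.

HB.instance Definition _ := Lmodule_isLieAlgebra.Build K free_lie
  free_lie_bracketDl free_lie_bracketDr free_lie_bracketZl free_lie_bracketZr
  free_lie_bracketxx free_lie_jacobi.

Lemma free_lie_piB s t : cl (TBracket s t) = lieb (cl s) (cl t).
Proof. by rewrite -free_lie_bracketE. Qed.

Section UniversalProperty.
Context (L : lieAlgType K) (h : X -> L).

Fixpoint lie_eval (s : term) : L :=
  match s with
  | TVar x => h x
  | TZero => 0
  | TOpp s => - lie_eval s
  | TAdd s t => lie_eval s + lie_eval t
  | TScale a s => a *: lie_eval s
  | TBracket s t => lieb (lie_eval s) (lie_eval t)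
  end.

Lemma lie_eval_cong s t : lie_cong s t -> lie_eval s = lie_eval t.
Proof.
elim=> //= *; do ?congruence.
- exact: addrA.
- exact: addrC.
- exact: add0r.
- exact: addNr.
- exact: scalerA.
- exact: scale1r.
- exact: scalerDr.
- exact: scalerDl.
- exact: liebDl.
- exact: liebDr.
- exact: liebZl.
- exact: liebZr.
- exact: liebxx.
- exact: lieb_jacobi.
Qed.

Definition free_lie_lift_fun (u : free_lie) : L := lie_eval (repr u).

Lemma free_lie_lift_funE s : free_lie_lift_fun (cl s) = lie_eval s.
Proof. exact/lie_eval_cong/free_lie_repr. Qed.

Lemma free_lie_lift_linear : linear free_lie_lift_fun.
Proof.
move=> a; elim/quotW=> s; elim/quotW=> t.
by rewrite -free_lie_piZ -free_lie_piD !free_lie_lift_funE.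
Qed.

Lemma free_lie_lift_bracket u v :
  free_lie_lift_fun (lieb u v) =
  lieb (free_lie_lift_fun u) (free_lie_lift_fun v).
Proof.
elim/quotW: u => s; elim/quotW: v => t.
by rewrite -free_lie_piB !free_lie_lift_funE.
Qed.

Definition free_lie_lift : lie_hom free_lie L :=
  LieHom free_lie_lift_linear free_lie_lift_bracket.

Lemma free_lie_lift_var x : free_lie_lift (free_lie_var x) = h x.
Proof. exact: free_lie_lift_funE. Qed.

Lemma free_lie_lift_unique (f : lie_hom free_lie L) :
  (forall x, f (free_lie_var x) = h x) -> f = free_lie_lift.
Proof.
move=> fh; apply: lie_hom_ext; elim/quotW=> s.
rewrite [RHS]free_lie_lift_funE.
elim: s => /= [x||s IHs|s IHs t IHt|a s IHs|s IHs t IHt].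
- exact: fh.
- exact: (linear0 f).
- by rewrite free_lie_piN -IHs; exact: (linearN f).
- by rewrite free_lie_piD -IHs -IHt; exact: (linearD f).
- by rewrite free_lie_piZ -IHs; exact: (linearZ_LR f).
- by rewrite free_lie_piB lie_funM IHs IHt.
Qed.

End UniversalProperty.
End FreeLie.

(* Over a nontrivial ring distinct X give distinct free Lie algebras F(X), so
   the objects F(X) are represented by the finite sets X themselves. *)
Definition free_lie_category (K : comNzRingType) (X0 : choiceType) : category :=
  @full_subcategory (lie_category K) {fset X0}
    (fun X : {fset X0} => free_lie K X : lieAlgType K).

Definition semi_isomorphism (K : comNzRingType) (A1 A2 : lieAlgType K)
    (delta : {rmorphism K -> K}) (f : A1 -> A2) : Prop :=
  [/\ bijective delta,
      bijective f,
      forall u v, f (u + v) = f u + f v,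
      forall u v, f (lieb u v) = lieb (f u) (f v)
    & forall (a : K) u, f (a *: u) = delta a *: f u].

Definition semi_inner (K : comNzRingType) (X0 : choiceType)
    (phi : functor (free_lie_category K X0) (free_lie_category K X0)) : Prop :=
  exists (delta : {rmorphism K -> K})
         (s : forall X : {fset X0}, free_lie K X -> free_lie K (phi X)),
    (forall X : {fset X0}, semi_isomorphism delta (s X)) /\
    (forall (X Y : {fset X0}) (nu : lie_hom (free_lie K X) (free_lie K Y)),
       (fmap phi nu : lie_hom (free_lie K (phi X)) (free_lie K (phi Y))) \o s X
       =1 s Y \o nu).

(* Main.v *)
Require Import Defs.
From mathcomp Require Import all_boot all_order all_algebra.
From mathcomp Require Import finmap.
From mathcomp Require Import boolp classical_sets cardinality.
From HB Require Import structures.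

Set Implicit Arguments.
Unset Strict Implicit.
Unset Printing Implicit Defensive.

Import Order.TTheory GRing.Theory.
Local Open Scope ring_scope.

(** Write F(X) for the free Lie algebra.  The idea is to see the automorphism
    as a change of the Lie operations on the sets F(X), and to show that such a
    change is given by words so rigid that only a ring automorphism of K and a
    unit of K are left.

    The object F(x) on one generator has a commutative nontrivial endomorphism
    monoid, and no other object has ([phi_X1_rank1]); so phi maps it to some
    F(y).  As Hom(F(x), A) is the underlying set of A, reading phi on these
    morphisms gives bijections s_A : A -> phi(A), natural in A ([transfer]).
    Pulling the operations of phi(A) back along s_A gives operations on A that
    commute with every homomorphism, and a natural binary operation is the
    evaluation of one element w of the free Lie algebra on two letters
    ([natural_op_word]).  Its identities then hold in every Lie algebra, because
    they hold in free Lie algebras on three letters ([three_generators]); hence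
    w may be tested in any Lie algebra one likes.

    - s_A (k a) = d(k) s_A(a) for some bijective multiplicative d : K -> K, since
      the elements of F(y) are the multiples of y.
    - A w that defines a commutative associative operation with unit 0 is x + y
      ([addition_wordE]).  Test it in the Lie algebra A + A where A acts on the
      second summand by multiplication.  Over A = K[s], associativity makes
      some polynomial invertible, hence constant; this says that w(a, m) = a + m
      for m in the second summand.  Using associativity again, both Fox
      derivatives of w are equal to 1, that is, w = x + y as a noncommutative
      polynomial.  No homogeneity is used, so K may be finite.  It follows that
      s_A is additive and d is a ring automorphism.
    - A biadditive w is c [x, y] ([bilinear_wordE]): a word with a letter that
      does not occur exactly once is detected by substituting a sum of two
      letters for that letter.

    Applying the last point to s and to its inverse gives
    s [a, b] = c [s a, s b] with c a unit, and c s is then a family of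
    semi-isomorphisms ([automorphism_semi_inner]).

    The last two tests determine w only as a noncommutative polynomial.  That
    this is enough is the theorem of Magnus and Witt that the free Lie algebra
    embeds into the free associative algebra, here for a finite alphabet and over
    any commutative ring ([magnus_inj]); it is proved with the Lyndon basis, by
    showing that the standard bracketings of Lyndon words span and that distinct
    ones have distinct leading words. *)

(** * Lyndon words and their standard bracketings *)

Inductive bracketing (T : Type) : Type :=
| Letter of T
| Bracket of bracketing T & bracketing T.

HB.instance Definition _ (T : Type) := gen_eqMixin (bracketing T).

Section Words.
Context (d : Order.disp_t) (T : orderType d).
Implicit Types u v w : seqlexi T.

Lemma wlt_cat2l u v w : ((u ++ v : seqlexi T) < u ++ w)%O = (v < w)%O.
Proof. by elim: u => //= x u IH; rewrite eqhead_ltxiE. Qed.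

Lemma wlt_cat u w : (u < u ++ w :> seqlexi T)%O = (w != [::]).
Proof. by rewrite -[X in (X < _)%O]cats0 wlt_cat2l ltxi0s. Qed.

(** A strict lexicographic inequality between words that are not prefixes of one
    another is decided at a letter, so it survives any right extension. *)
Lemma wlt_prefix u v : (u < v)%O ->
  (exists2 w, w != [::] & v = u ++ w) \/
  forall a b : seqlexi T, (u ++ a < v ++ b :> seqlexi T)%O.
Proof.
elim: u v => [|x u IH] [|y v] //; first by left; exists (y :: v).
have [-> |nxy] := eqVneq x y.
  rewrite eqhead_ltxiE => /IH[[w w0 ->]|H]; first by left; exists w.
  by right=> a b; rewrite /= eqhead_ltxiE.
rewrite neqhead_ltxiE // => lxy; right=> a b /=.
by rewrite neqhead_ltxiE.
Qed.

Lemma wlt_cat_short u v a b : (u < v)%O -> (size v <= size u)%N ->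
  (u ++ a < v ++ b :> seqlexi T)%O.
Proof.
case/wlt_prefix=> [[w w0 ->]|->//]; rewrite size_cat.
by case: w w0 => //= x w _; rewrite addnS ltnNge leq_addr.
Qed.

Definition lyndon (w : seqlexi T) : Prop :=
  w != [::] /\
  forall u v, u != [::] -> v != [::] -> w = u ++ v -> (w < v)%O.

Lemma lyndon1 (x : T) : lyndon [:: x].
Proof. by split=> // -[|y [|z u]] [|t v]. Qed.

Lemma cat_eq_cat (U : Type) (u v a b : seq U) : u ++ v = a ++ b ->
  (exists s, u = a ++ s /\ b = s ++ v) \/ (exists s, a = u ++ s /\ v = s ++ b).
Proof.
elim: a u => [|x a IH] [|y u] //=.
- by move=> <-; left; exists [::].
- by move=> <-; left; exists (y :: u).
- by move=> ->; right; exists (x :: a).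
- by case=> -> /IH[[s [-> ->]]|[s [-> ->]]]; [left|right]; exists s.
Qed.

Lemma lyndon_cat_ltr u v :
  lyndon u -> lyndon v -> (u < v)%O -> (u ++ v < v :> seqlexi T)%O.
Proof.
move=> [u0 Lu] [v0 Lv] ltuv.
have [[r r0 Ev]|H] := wlt_prefix ltuv; last by rewrite -[ltRHS]cats0.
by rewrite {2}Ev wlt_cat2l; apply: Lv Ev.
Qed.

Lemma lyndon_cat u v :
  lyndon u -> lyndon v -> (u < v)%O -> lyndon (u ++ v).
Proof.
move=> Lu Lv ltuv; have uvv := lyndon_cat_ltr Lu Lv ltuv.
case: Lu Lv => [u0 Lu] [v0 Lv].
split=> [|a b a0 b0 /cat_eq_cat[[s [Eu ->]]|[s [Ea Ev]]]].
- by case: u u0 {Lu ltuv uvv}.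
- have [-> //|s0] := eqVneq s [::].
  apply: wlt_cat_short; first exact: (Lu a s).
  by rewrite Eu size_cat leq_addl.
- have [s0|s0] := eqVneq s [::]; first by move: uvv; rewrite Ev s0.
  by apply: lt_trans uvv _; apply: (Lv s b).
Qed.

Fixpoint foliage (t : bracketing T) : seqlexi T :=
  match t with
  | Letter x => [:: x]
  | Bracket l r => foliage l ++ foliage r
  end.

(** These are the Hall bracketings for the lexicographic order of the foliage.
    The condition on [l] makes [foliage r] the least proper suffix of the
    whole foliage ([standard_right_min]), so that a word has at most one standard
    bracketing. *)
Fixpoint standard (t : bracketing T) : bool :=
  match t with
  | Letter _ => true
  | Bracket l r =>
      [&& standard l, standard r, (foliage l < foliage r)%O &
          if l is Bracket _ l2 then (foliage r <= foliage l2)%O else true]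
  end.

Lemma standardE l r : standard (Bracket l r) =
  [&& standard l, standard r, (foliage l < foliage r)%O &
      if l is Bracket _ l2 then (foliage r <= foliage l2)%O else true].
Proof. by []. Qed.

Lemma foliage_lyndon t : standard t -> lyndon (foliage t).
Proof.
elim: t => [x _|l IHl r IHr /= /and4P[/IHl Ll /IHr Lr lr _]].
  exact: lyndon1.
exact: lyndon_cat.
Qed.

Lemma foliage_neq0 t : foliage t != [::].
Proof. by elim: t => //= l; case: (foliage l). Qed.

Lemma standard_right_min l r u v : standard (Bracket l r) ->
  u != [::] -> v != [::] -> foliage l ++ foliage r = u ++ v ->
  (foliage r <= v)%O.
Proof.
elim: l r u v => [x|l1 IH l2 _] r u v;
  rewrite standardE => /and4P[Gl Gr lr rl] u0 v0 E;
  have {E}[[s [El ->]]|[s [Eu Er]]] := cat_eq_cat E.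
- by case: u El u0 => [|y [|z u]] // [_ <-].
- have [s0|s0] := eqVneq s [::]; first by rewrite Er s0.
  by apply: ltW; apply: (foliage_lyndon Gr).2 Er.
- have [->//|s0] := eqVneq s [::].
  have sle := IH l2 u s Gl u0 s0 El.
  by rewrite (le_trans rl) // (le_trans sle) // ltW // wlt_cat foliage_neq0.
- have [s0|s0] := eqVneq s [::]; first by rewrite Er s0.
  by apply: ltW; apply: (foliage_lyndon Gr).2 Er.
Qed.

(** The right factor is recovered from the foliage as its least proper suffix. *)
Lemma standard_inj t1 t2 :
  standard t1 -> standard t2 -> foliage t1 = foliage t2 -> t1 = t2.
Proof.
elim: t1 t2 => [x|l1 IHl r1 IHr] [y|l2 r2] // G1 G2.
- by case=> ->.
- have := foliage_neq0 l2; have := foliage_neq0 r2 => /=.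
  by case: (foliage l2) => // a [|b u]; case: (foliage r2).
- have := foliage_neq0 l1; have := foliage_neq0 r1 => /=.
  by case: (foliage l1) => // a [|b u]; case: (foliage r1).
move=> E; have Er : foliage r1 = foliage r2.
  apply/eqP; rewrite eq_le.
  rewrite (standard_right_min G1 (foliage_neq0 l2) (foliage_neq0 r2) E).
  exact: (standard_right_min G2 (foliage_neq0 l1) (foliage_neq0 r1) (esym E)).
have El : foliage l1 = foliage l2.
  have /= := congr1 size E; rewrite !size_cat Er => /addIn sl.
  by move: E; rewrite /= Er => /eqP; rewrite eqseq_cat // => /andP[/eqP].
case/and4P: G1 => Gl1 Gr1 _ _; case/and4P: G2 => Gl2 Gr2 _ _.
by rewrite (IHl l2) // (IHr r2).
Qed.

End Words.

(** * Commutator Lie algebras *)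

Section Commutator.
Context (K : comNzRingType) (A : lmodType K) (mul : A -> A -> A).
Hypothesis mulDl : forall x y z, mul (x + y) z = mul x z + mul y z.
Hypothesis mulDr : forall x y z, mul x (y + z) = mul x y + mul x z.
Hypothesis mulZl : forall (a : K) x y, mul (a *: x) y = a *: mul x y.
Hypothesis mulZr : forall (a : K) x y, mul x (a *: y) = a *: mul x y.
Hypothesis mulA : forall x y z, mul x (mul y z) = mul (mul x y) z.

Definition commutator x y := mul x y - mul y x.

Lemma commutatorDl x y z :
  commutator (x + y) z = commutator x z + commutator y z.
Proof. by rewrite /commutator mulDl mulDr opprD addrACA. Qed.

Lemma commutatorDr x y z :
  commutator x (y + z) = commutator x y + commutator x z.
Proof. by rewrite /commutator mulDl mulDr opprD addrACA. Qed.

Lemma commutatorZl (a : K) x y : commutator (a *: x) y = a *: commutator x y.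
Proof. by rewrite /commutator mulZl mulZr scalerBr. Qed.

Lemma commutatorZr (a : K) x y : commutator x (a *: y) = a *: commutator x y.
Proof. by rewrite /commutator mulZl mulZr scalerBr. Qed.

Lemma commutatorxx x : commutator x x = 0.
Proof. exact: subrr. Qed.

Lemma commutator_jacobi x y z :
  commutator x (commutator y z) + commutator y (commutator z x)
  + commutator z (commutator x y) = 0.
Proof.
have mulNl u v : mul (- u) v = - mul u v by rewrite -!scaleN1r mulZl.
have mulNr u v : mul u (- v) = - mul u v by rewrite -!scaleN1r mulZr.
rewrite /commutator !(mulDl, mulDr, mulNl, mulNr, mulA) !opprB.
(* The twelve monomials cancel in pairs, listed here by their positions. *)
rewrite (AC ((2*2)*(2*2)*(2*2)) (((1*12)*(2*7))*((3*10)*(4*5))*((6*11)*(8*9)))) /=.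
by rewrite ?(addNr, subrr, addr0).
Qed.
End Commutator.

Section CommutatorLie.
Context (K : comNzRingType) (A : algType K).

Definition commutator_lie : Type := A.
HB.instance Definition _ := GRing.Lmodule.copy commutator_lie A.
HB.instance Definition _ := Lmodule_isLieAlgebra.Build K commutator_lie
  (commutatorDl (@mulrDl A) (@mulrDr A)) (commutatorDr (@mulrDl A) (@mulrDr A))
  (commutatorZl (fun a x y => esym (@scalerAl K A a x y))
    (fun a x y => esym (@scalerAr K A a x y)))
  (commutatorZr (fun a x y => esym (@scalerAl K A a x y))
    (fun a x y => esym (@scalerAr K A a x y)))
  (commutatorxx *%R)
  (commutator_jacobi (@mulrDl A) (@mulrDr A)
    (fun a x y => esym (@scalerAl K A a x y))
    (fun a x y => esym (@scalerAr K A a x y)) (@mulrA A)).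

Lemma commutator_lieE (x y : commutator_lie) :
  lieb x y = (x : A) * (y : A) - (y : A) * (x : A).
Proof. by []. Qed.
End CommutatorLie.

Section AffineLie.
Context (K : comNzRingType) (A : algType K).
Local Notation V := (A * A)%type.

(** This is the product of the matrices [[0, m], [0, a]], written as (a, m).  In
    the commutator Lie algebra the elements (0, m) form an abelian ideal on which
    A acts by right multiplication, up to sign. *)
Definition affine_mul (x y : V) : V := (x.1 * y.1, x.2 * y.1).

Lemma affine_mulDl x y z :
  affine_mul (x + y) z = affine_mul x z + affine_mul y z.
Proof. by rewrite /affine_mul /= !mulrDl. Qed.

Lemma affine_mulDr x y z :
  affine_mul x (y + z) = affine_mul x y + affine_mul x z.
Proof. by rewrite /affine_mul /= !mulrDr. Qed.

Lemma affine_mulZl (a : K) x y : affine_mul (a *: x) y = a *: affine_mul x y.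
Proof. by rewrite /affine_mul /= -!scalerAl. Qed.

Lemma affine_mulZr (a : K) x y : affine_mul x (a *: y) = a *: affine_mul x y.
Proof. by rewrite /affine_mul /= -!scalerAr. Qed.

Lemma affine_mulA x y z :
  affine_mul x (affine_mul y z) = affine_mul (affine_mul x y) z.
Proof. by rewrite /affine_mul /= !mulrA. Qed.

Definition affine_lie : Type := V.
HB.instance Definition _ := GRing.Lmodule.copy affine_lie V.
HB.instance Definition _ := Lmodule_isLieAlgebra.Build K affine_lie
  (commutatorDl affine_mulDl affine_mulDr)
  (commutatorDr affine_mulDl affine_mulDr)
  (commutatorZl affine_mulZl affine_mulZr)
  (commutatorZr affine_mulZl affine_mulZr)
  (commutatorxx affine_mul)
  (commutator_jacobi affine_mulDl affine_mulDr affine_mulZl affine_mulZr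
    affine_mulA).

Lemma affine_lieE (x y : affine_lie) :
  lieb x y = (x.1 * y.1 - y.1 * x.1, x.2 * y.1 - y.2 * x.1).
Proof. by []. Qed.

Lemma affine_lie_pairE (a m b n : A) :
  lieb ((a, m) : affine_lie) (b, n) = (a * b - b * a, m * b - n * a).
Proof. by []. Qed.
End AffineLie.

(** * Noncommutative formal power series *)

Section Series.
Context (K : comNzRingType) (T : Type).

Definition ncseries : Type := seq T -> K.
HB.instance Definition _ := gen_eqMixin ncseries.
HB.instance Definition _ := gen_choiceMixin ncseries.
Implicit Types f g h : ncseries.

Definition ncs_zero : ncseries := fun _ => 0.
Definition ncs_opp f : ncseries := fun m => - f m.
Definition ncs_add f g : ncseries := fun m => f m + g m.
Definition ncs_scale (a : K) f : ncseries := fun m => a * f m.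
Definition ncs_one : ncseries := fun m => (nilp m)%:R.
Definition ncs_der (t : T) f : ncseries := fun m => f (t :: m).
(** The convolution product, by recursion on the word: the left factor is either
    empty or starts with the first letter.  With this form every identity is an
    induction that replaces [f] by a derivative of [f]. *)
Fixpoint ncs_mul_rec (m : seq T) f g : K :=
  if m is t :: m' then f [::] * g m + ncs_mul_rec m' (ncs_der t f) g
  else f [::] * g [::].
Definition ncs_mul f g : ncseries := fun m => ncs_mul_rec m f g.

Lemma ncs_addA : associative ncs_add.
Proof. by move=> f g h; apply/funext=> m; apply: addrA. Qed.
Lemma ncs_addC : commutative ncs_add.
Proof. by move=> f g; apply/funext=> m; apply: addrC. Qed.
Lemma ncs_add0 : left_id ncs_zero ncs_add.
Proof. by move=> f; apply/funext=> m; apply: add0r. Qed.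
Lemma ncs_addN : left_inverse ncs_zero ncs_opp ncs_add.
Proof. by move=> f; apply/funext=> m; apply: addNr. Qed.
HB.instance Definition _ := GRing.isZmodule.Build ncseries
  ncs_addA ncs_addC ncs_add0 ncs_addN.

Lemma ncs_scaleA a b f : ncs_scale a (ncs_scale b f) = ncs_scale (a * b) f.
Proof. by apply/funext=> m; apply: mulrA. Qed.
Lemma ncs_scale1 : left_id 1 ncs_scale.
Proof. by move=> f; apply/funext=> m; apply: mul1r. Qed.
Lemma ncs_scaleDr : right_distributive ncs_scale +%R.
Proof. by move=> a f g; apply/funext=> m; apply: mulrDr. Qed.
Lemma ncs_scaleDl f : {morph ncs_scale^~ f : a b / a + b}.
Proof. by move=> a b; apply/funext=> m; apply: mulrDl. Qed.
HB.instance Definition _ := GRing.Zmodule_isLmodule.Build K ncseries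
  ncs_scaleA ncs_scale1 ncs_scaleDr ncs_scaleDl.

Lemma ncs0E m : (0 : ncseries) m = 0. Proof. by []. Qed.
Lemma ncsDE f g m : (f + g) m = f m + g m. Proof. by []. Qed.
Lemma ncsNE f m : (- f) m = - f m. Proof. by []. Qed.
Lemma ncsZE a f m : (a *: f) m = a * f m. Proof. by []. Qed.
Lemma ncs_derE t f m : ncs_der t f m = f (t :: m). Proof. by []. Qed.

Lemma ncs_mul_nil f g : ncs_mul f g [::] = f [::] * g [::].
Proof. by []. Qed.

Lemma ncs_mul_cons f g t m :
  ncs_mul f g (t :: m) = f [::] * g (t :: m) + ncs_mul (ncs_der t f) g m.
Proof. by []. Qed.

Lemma ncs_mulDl : left_distributive ncs_mul +%R.
Proof.
move=> f g h; apply/funext=> m; rewrite ncsDE.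
elim: m f g => [|t m IH] f g; first by rewrite !ncs_mul_nil ncsDE mulrDl.
rewrite !ncs_mul_cons ncsDE mulrDl addrACA -IH; congr (_ + _).
Qed.

Lemma ncs_mulDr : right_distributive ncs_mul +%R.
Proof.
move=> f g h; apply/funext=> m; rewrite ncsDE.
elim: m f => [|t m IH] f; first by rewrite !ncs_mul_nil ncsDE mulrDr.
by rewrite !ncs_mul_cons ncsDE mulrDr addrACA -IH.
Qed.

Lemma ncs_mulZl a f g : ncs_mul (a *: f) g = a *: ncs_mul f g.
Proof.
apply/funext=> m; rewrite ncsZE.
elim: m f => [|t m IH] f; first by rewrite !ncs_mul_nil ncsZE mulrA.
by rewrite !ncs_mul_cons ncsZE mulrDr mulrA -IH.
Qed.

Lemma ncs_mulZr a f g : ncs_mul f (a *: g) = a *: ncs_mul f g.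
Proof.
apply/funext=> m; rewrite ncsZE.
elim: m f => [|t m IH] f; first by rewrite !ncs_mul_nil ncsZE mulrCA.
by rewrite !ncs_mul_cons ncsZE mulrDr mulrCA IH.
Qed.

Lemma ncs_der_mul t f g :
  ncs_der t (ncs_mul f g) =
  f [::] *: ncs_der t g + ncs_mul (ncs_der t f) g.
Proof. by []. Qed.

Lemma ncs_mulA : associative ncs_mul.
Proof.
move=> f g h; apply/funext=> m.
elim: m f => [|t m IH] f; first by rewrite !ncs_mul_nil mulrA.
rewrite !ncs_mul_cons ncs_der_mul ncs_mulDl ncs_mulZl ncsDE ncsZE IH.
by rewrite mulrDr mulrA addrA.
Qed.

Lemma ncs_mul0 g : ncs_mul 0 g = 0.
Proof. by have := ncs_mulZl 0 0 g; rewrite !scale0r. Qed.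

Lemma ncs_mul1l : left_id ncs_one ncs_mul.
Proof.
move=> f; apply/funext=> -[|t m]; first by rewrite ncs_mul_nil mul1r.
by rewrite ncs_mul_cons mul1r [ncs_der _ _](_ : _ = 0) // ncs_mul0 addr0.
Qed.

Lemma ncs_mul1r : right_id ncs_one ncs_mul.
Proof.
move=> f; apply/funext=> m; elim: m f => [|t m IH] f.
  by rewrite ncs_mul_nil mulr1.
by rewrite ncs_mul_cons mulr0 add0r IH.
Qed.

Lemma ncs_oner_neq0 : ncs_one != 0.
Proof.
apply/eqP=> /(congr1 (fun f : ncseries => f [::])) /eqP.
by rewrite /ncs_one ncs0E /= oner_eq0.
Qed.

HB.instance Definition _ := GRing.Zmodule_isNzRing.Build ncseries
  ncs_mulA ncs_mul1l ncs_mul1r ncs_mulDl ncs_mulDr ncs_oner_neq0.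
HB.instance Definition _ := GRing.Lmodule_isLalgebra.Build K ncseries
  (fun a f g => esym (ncs_mulZl a f g)).
HB.instance Definition _ := GRing.Lalgebra_isAlgebra.Build K ncseries
  (fun a f g => esym (ncs_mulZr a f g)).

Lemma ncsM_nil f g : (f * g) [::] = f [::] * g [::].
Proof. by []. Qed.

Lemma ncsM_cons f g t m :
  (f * g) (t :: m) = f [::] * g (t :: m) + (ncs_der t f * g) m.
Proof. by []. Qed.

Definition homogeneous n f := forall m, size m != n -> f m = 0.

Lemma ncs_mul_homogeneous n f g m : homogeneous n f ->
  (f * g) m = if (n <= size m)%N then f (take n m) * g (drop n m) else 0.
Proof.
rewrite -[(f * g) m]/(ncs_mul f g m).
elim: n m f => [|n IH] [|t m] f hf; rewrite ?ncs_mul_cons.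
- by [].
- rewrite [ncs_der t f](_ : _ = 0) ?ncs_mul0 ?addr0 //.
  by apply/funext=> m'; apply: hf.
- by rewrite ncs_mul_nil hf ?mul0r.
- rewrite (hf [::]) // mul0r add0r IH //.
  by move=> m' hm'; apply: hf.
Qed.
End Series.

(** * Lie algebras and free Lie algebras *)

Section LieLemmas.
Context (K : comNzRingType) (L : lieAlgType K).
Implicit Types x y z : L.

Lemma lieb0l x : lieb 0 x = 0.
Proof. by have := liebZl 0 0 x; rewrite !scale0r. Qed.

Lemma lieb0r x : lieb x 0 = 0.
Proof. by have := liebZr 0 x 0; rewrite !scale0r. Qed.

Lemma liebC x y : lieb x y = - lieb y x.
Proof.
apply/eqP; rewrite -addr_eq0; apply/eqP.
by have := liebxx (x + y); rewrite liebDl !liebDr !liebxx add0r addr0.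
Qed.

Lemma liebNr x y : lieb x (- y) = - lieb x y.
Proof. by rewrite -!scaleN1r liebZr. Qed.

Lemma lieb_leibniz x y z :
  lieb (lieb x y) z = lieb (lieb x z) y + lieb x (lieb y z).
Proof.
rewrite (liebC (lieb x y)) (liebC (lieb x z) y) (liebC x z) liebNr opprK addrC.
by apply/esym/eqP; rewrite -addr_eq0 lieb_jacobi.
Qed.
End LieLemmas.

Section LieHomLinear.
Context (K : comNzRingType) (A B : lieAlgType K) (f : lie_hom A B).

Lemma lie_hom0 : f 0 = 0. Proof. exact: (linear0 f). Qed.
Lemma lie_homD u v : f (u + v) = f u + f v. Proof. exact: (linearD f). Qed.
Lemma lie_homN u : f (- u) = - f u. Proof. exact: (linearN f). Qed.
Lemma lie_homZ a u : f (a *: u) = a *: f u. Proof. exact: (linearZ_LR f). Qed.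
Lemma lie_hom_sum I (r : seq I) (P : pred I) (E : I -> A) :
  f (\sum_(i <- r | P i) E i) = \sum_(i <- r | P i) f (E i).
Proof. exact: (linear_sum f). Qed.
End LieHomLinear.

Lemma lie_compE (K : comNzRingType) (A B C : lieAlgType K)
  (g : lie_hom B C) (f : lie_hom A B) u : lie_comp g f u = g (f u).
Proof. by []. Qed.

Section FreeLieInduction.
Context (K : comNzRingType) (X : Type).

Lemma free_lie_ind (P : free_lie K X -> Prop) :
  (forall x, P (free_lie_var K x)) -> P 0 ->
  (forall u v, P u -> P v -> P (u + v)) ->
  (forall a u, P u -> P (a *: u)) ->
  (forall u v, P u -> P v -> P (lieb u v)) ->
  forall u, P u.
Proof.
move=> Pvar P0 PD PZ PB; elim/quotW; elim=> //.
- by move=> s Ps; rewrite free_lie_piN -scaleN1r; apply: PZ.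
- by move=> s Ps t Pt; rewrite free_lie_piD; apply: PD.
- by move=> a s Ps; rewrite free_lie_piZ; apply: PZ.
- by move=> s Ps t Pt; rewrite free_lie_piB; apply: PB.
Qed.

Lemma free_lie_hom_eq (L : lieAlgType K) (f g : lie_hom (free_lie K X) L) :
  (forall x, f (free_lie_var K x) = g (free_lie_var K x)) -> f = g.
Proof.
by move=> fg; rewrite (free_lie_lift_unique fg); apply/esym/free_lie_lift_unique.
Qed.
End FreeLieInduction.

(** * The embedding into noncommutative series *)

Section Magnus.
Context (K : comNzRingType) (X : eqType).

Definition letter (x : X) : commutator_lie (ncseries K X) :=
  fun m => (m == [:: x])%:R.

Definition magnus : lie_hom (free_lie K X) (commutator_lie (ncseries K X)) :=
  free_lie_lift letter.

Lemma magnus_var x : magnus (free_lie_var K x) = letter x.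
Proof. exact: free_lie_lift_var. Qed.

Lemma magnus_nil u : magnus u [::] = 0.
Proof.
elim/free_lie_ind: u => [x||u v IHu IHv|a u IHu|u v IHu IHv].
- by rewrite magnus_var.
- by rewrite lie_hom0.
- by rewrite lie_homD ncsDE IHu IHv addr0.
- by rewrite lie_homZ ncsZE IHu mulr0.
- by rewrite lie_funM commutator_lieE ncsDE ncsNE !ncsM_nil mulrC subrr.
Qed.
End Magnus.
Arguments letter {K X}.
Arguments magnus {K X}.

Section LyndonBasis.
Context (K : comNzRingType) (d : Order.disp_t) (T : finOrderType d).
Local Notation F := (free_lie K T).
Local Notation S := (ncseries K T).
Implicit Types (w : seqlexi T) (t l r : bracketing T).

Fixpoint lie_of t : F :=
  match t with
  | Letter x => free_lie_var K x
  | Bracket l r => lieb (lie_of l) (lie_of r)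
  end.

Definition leads w (f : S) : Prop :=
  [/\ homogeneous (size w) f, forall m : seqlexi T, (m < w)%O -> f m = 0
    & f w = 1].

(** Among factors of prescribed lengths, concatenation is monotone for the
    lexicographic order, so least words multiply. *)
Lemma leads_mul (u v : seqlexi T) (f g : S) :
  leads u f -> leads v g -> leads (u ++ v) (f * g).
Proof.
move=> [fh fl f1] [gh gl g1]; split=> [m|m lm|].
- rewrite (ncs_mul_homogeneous _ _ fh) size_cat => sm.
  case: ifP => // le; rewrite (gh (drop _ _)) ?mulr0 //.
  by apply: contra sm => /eqP; rewrite size_drop => <-; rewrite subnKC.
- rewrite (ncs_mul_homogeneous _ _ fh); case: ifP => // le.
  have st : size (take (size u) m) = size u by rewrite size_takel.
  move: lm; rewrite -{1}(cat_take_drop (size u) m).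
  case: (ltgtP (take (size u) m : seqlexi T) u) => [lt _|gt lt|eu].
  + by rewrite fl ?mul0r.
  + have := wlt_cat_short v (drop (size u) m) gt.
    by rewrite st => /(_ (leqnn _)) /(lt_trans lt); rewrite ltxx.
  + by rewrite eu wlt_cat2l => /gl ->; rewrite mulr0.
- rewrite (ncs_mul_homogeneous _ _ fh) size_cat leq_addr.
  by rewrite take_size_cat // drop_size_cat // f1 g1 mulr1.
Qed.

(** For Lyndon words u < v one has uv < v < vu, so the least word of
    [f * g - g * f] comes from the first product. *)
Lemma leads_magnus t : standard t -> leads (foliage t) (magnus (lie_of t)).
Proof.
elim: t => [x _|l IHl r IHr].
  rewrite magnus_var; split=> [m sm|m lm|]; rewrite /letter; last by rewrite eqxx.
  - by have [mx|//] := eqVneq; rewrite mx eqxx in sm.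
  - by have [mx|//] := eqVneq; rewrite mx ltxx in lm.
rewrite standardE => /and4P[Gl Gr lr _].
have Ll := foliage_lyndon Gl; have Lr := foliage_lyndon Gr.
have lt : (foliage l ++ foliage r < foliage r ++ foliage l :> seqlexi T)%O.
  by rewrite (lt_trans (lyndon_cat_ltr Ll Lr lr)) // wlt_cat foliage_neq0.
have [h1 l1 e1] := leads_mul (IHl Gl) (IHr Gr).
have [h2 l2 e2] := leads_mul (IHr Gr) (IHl Gl).
rewrite [lie_of _]/= [foliage _]/= lie_funM commutator_lieE.
split=> [m sm|m ltm|]; rewrite ncsDE ncsNE.
- by rewrite [X in X - _]h1 // [X in _ - X]h2 ?subrr // size_cat addnC -size_cat.
- by rewrite [X in X - _]l1 // [X in _ - X]l2 ?subrr // (lt_trans ltm).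
- by rewrite [X in X - _]e1 [X in _ - X]l2 ?subr0.
Qed.

(** Inductive rather than a sum over a sequence, so that the spanning argument
    can proceed term by term. *)
Inductive span (P : bracketing T -> Prop) : F -> Prop :=
| span0 : span P 0
| spanS a t u : P t -> span P u -> span P (a *: lie_of t + u).

Lemma span_gen (P : bracketing T -> Prop) t : P t -> span P (lie_of t).
Proof.
by move=> Pt; rewrite -[lie_of t]scale1r -[_ *: _]addr0; constructor=> //; constructor.
Qed.

Lemma spanD P u v : span P u -> span P v -> span P (u + v).
Proof.
by elim=> [|a t u' Pt _ IH] Pv; rewrite ?add0r // -addrA; constructor; auto.
Qed.

Lemma spanZ P a u : span P u -> span P (a *: u).
Proof.
elim=> [|b t u' Pt _ IH]; first by rewrite scaler0; constructor.
by rewrite scalerDr scalerA; constructor.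
Qed.

Lemma spanN P u : span P u -> span P (- u).
Proof. by rewrite -scaleN1r; apply: spanZ. Qed.

Lemma span_bind (P Q : bracketing T -> Prop) (f : F -> F) u :
  (forall x y, f (x + y) = f x + f y) -> (forall a x, f (a *: x) = a *: f x) ->
  (forall t, P t -> span Q (f (lie_of t))) -> span P u -> span Q (f u).
Proof.
move=> fD fZ PQ; elim=> [|a t u' Pt _ IH].
  by rewrite -(scale0r 0) fZ scale0r; constructor.
by rewrite fD fZ; apply: spanD => //; apply: spanZ; auto.
Qed.

Lemma span_sub (P Q : bracketing T -> Prop) u :
  (forall t, P t -> Q t) -> span P u -> span Q u.
Proof. by move=> PQ; elim=> *; constructor; auto. Qed.

(** Turns the strict order of the words of length at most [n] into a natural
    number, for use as an induction measure; this is where the alphabet has to be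
    finite. *)
Definition rank n w := #|[set x : n.-bseq T | ((x : seq T) < w :> seqlexi T)%O]|.

Lemma ltn_rank n v w : (v < w)%O -> (size v <= n)%N -> (rank n v < rank n w)%N.
Proof.
move=> vw sv; apply: proper_card; apply/properP; split.
  by apply/fintype.subsetP=> x; rewrite !inE => /lt_trans; apply.
by exists (Bseq sv); rewrite !inE //= ltxx.
Qed.

Definition below n w t : Prop :=
  [/\ standard t, size (foliage t) = n & (foliage t < w)%O].

(** If the bracket of l = [l1, l2] and r is not standard then l2 < r, and
    [[l1, l2], r] = [[l1, r], l2] + [l1, [l2, r]].  The inner brackets are
    shorter, and by induction they are spanned by bracketings below r; so in all
    resulting outer brackets, of the same total length, both entries are below r.
    Hence the induction is on the total length, then on the larger entry.  The
    bound on the foliages in the conclusion is what keeps it going. *)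
Lemma span_bracket n l r : standard l -> standard r ->
  (size (foliage l) + size (foliage r) = n)%N -> (foliage l < foliage r)%O ->
  span (below n (foliage r)) (lieb (lie_of l) (lie_of r)).
Proof.
elim/ltn_ind: n l r => n IHn l r.
move: {-1}(rank n _) (leqnn (rank n (foliage r))) => k.
elim: k l r => [|k IHk] l r.
  rewrite leqn0 /rank => /eqP/cards0_eq r0 Gl Gr sz lr.
  have sl : (size (foliage l) <= n)%N by rewrite -sz leq_addr.
  by have := finset.in_set0 (Bseq sl); rewrite -r0 inE lr.
move=> rk Gl Gr sz lr.
case E: (standard (Bracket l r)).
  apply: (@span_gen _ (Bracket l r)); split=> //=; first by rewrite size_cat.
  exact: (lyndon_cat_ltr (foliage_lyndon Gl) (foliage_lyndon Gr)).
case: l Gl sz lr E => [x|l1 l2] Gl sz lr; first by rewrite /= Gr lr.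
rewrite standardE Gl Gr lr /= => /negbT; rewrite -ltNge => l2r.
have := Gl; rewrite standardE => /and4P[G1 G2 l12 _].
have s1 : (0 < size (foliage l1))%N by rewrite lt0n size_eq0 foliage_neq0.
have s2 : (0 < size (foliage l2))%N by rewrite lt0n size_eq0 foliage_neq0.
rewrite /= size_cat in sz.
(* The outer brackets: both entries are below r, so the inner induction
   applies once the entries are put in increasing order. *)
have pair a b : standard a -> standard b ->
    (size (foliage a) + size (foliage b))%N = n ->
    (foliage a < foliage r)%O -> (foliage b < foliage r)%O ->
    span (below n (foliage r)) (lieb (lie_of a) (lie_of b)).
  wlog le : a b / (foliage a <= foliage b)%O => [H|].
    case: (leP (foliage a) (foliage b)) => [/H|/ltW /H]; first exact.
    by move=> {}H *; rewrite liebC; apply: spanN; apply: H; rewrite // addnC.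
  move=> Ga Gb sab ar br; case: (ltgtP (foliage a) (foliage b)) le => // [ab _|E _].
    have sb : (size (foliage b) <= n)%N by rewrite -sab leq_addl.
    apply: (@span_sub (below n (foliage b))).
      by move=> t [Gt st tb]; split=> //; apply: lt_trans br.
    by apply: IHk => //; rewrite -ltnS (leq_trans (ltn_rank br sb)).
  by rewrite (standard_inj Ga Gb E) liebxx; constructor.
rewrite /= lieb_leibniz; apply: spanD.
- have l1r : (foliage l1 < foliage r)%O := lt_trans l12 l2r.
  have lt : (size (foliage l1) + size (foliage r) < n)%N.
    by rewrite -sz ltn_add2r -[ltnLHS]addn0 ltn_add2l.
  apply: (span_bind (f := fun u => lieb u (lie_of l2))
    _ _ _ (IHn _ lt _ _ G1 Gr erefl l1r)) => [x y|a x|].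
  - exact: liebDl.
  - exact: liebZl.
  by move=> t [Gt st tr]; apply: pair => //; rewrite st -sz addnAC.
- have lt : (size (foliage l2) + size (foliage r) < n)%N.
    by rewrite -sz -addnA -[ltnLHS]add0n ltn_add2r.
  apply: (span_bind (f := lieb (lie_of l1))
    _ _ _ (IHn _ lt _ _ G2 Gr erefl l2r)) => [x y|a x|].
  - exact: liebDr.
  - exact: liebZr.
  move=> t [Gt st tr]; apply: pair => //; last exact: lt_trans l2r.
  by rewrite st addnA.
Qed.

Lemma span_standard u : span (fun t => standard t) u.
Proof.
elim/free_lie_ind: u => [x||u v|a u|u v Su Sv].
- exact: (@span_gen _ (Letter x)).
- constructor.
- exact: spanD.
- exact: spanZ.
apply: (span_bind (f := fun u => lieb u v) _ _ _ Su); first by move=> x y; exact: liebDl.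
  by move=> a x; exact: liebZl.
move=> l Gl; apply: (span_bind (f := lieb (lie_of l)) _ _ _ Sv); first exact: liebDr.
  by move=> a x; exact: liebZr.
move=> r Gr; case: (ltgtP (foliage l) (foliage r)) => [lr|lr|E].
- by apply: span_sub (span_bracket Gl Gr erefl lr) => t [].
- by rewrite liebC; apply: spanN; apply: span_sub (span_bracket Gr Gl erefl lr) => t [].
- by rewrite (standard_inj Gl Gr E) liebxx; constructor.
Qed.

Lemma span_list P u : span P u -> exists s : seq (K * bracketing T),
  (forall p, p \in s -> P p.2) /\ u = \sum_(p <- s) p.1 *: lie_of p.2.
Proof.
elim=> [|a t v Pt _ [s [Ps ->]]]; first by exists [::]; rewrite big_nil.
exists ((a, t) :: s); split; last by rewrite big_cons.
by move=> p; rewrite inE => /predU1P[->|/Ps].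
Qed.

Lemma exists_min_foliage (s : seq (K * bracketing T)) : s != [::] ->
  exists2 p, p \in s & forall q, q \in s -> (foliage p.2 <= foliage q.2)%O.
Proof.
elim: s => // p [|q s] IH _.
  by exists p => [|r]; rewrite inE // => /eqP->.
have [//|r rs rmin] := IH.
have [le|lt] := leP (foliage p.2) (foliage r.2).
  exists p => [|q']; rewrite inE ?eqxx // => /predU1P[-> //|/rmin].
  exact: le_trans.
exists r => [|q']; rewrite inE ?rs ?orbT // => /predU1P[->|/rmin //].
exact: ltW.
Qed.

(** In a vanishing linear combination of standard bracketings, the one with the
    least foliage is alone to contribute to the coefficient of that word, so its
    coefficient vanishes. *)
Lemma magnus_inj : injective (@magnus K T).
Proof.
suff ker (u : F) : magnus u = 0 -> u = 0.
  by move=> u v uv; apply/subr0_eq/ker; rewrite lie_homD lie_homN uv subrr.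
have [s [Ps ->]] := span_list (span_standard u).
move: {-1}(size s) (leqnn (size s)) => n.
elim: n s Ps => [|n IH] s Ps; first by case: s Ps => // _ _; rewrite big_nil.
have [-> _ _|s0 sn] := eqVneq s [::]; first by rewrite big_nil.
have [p ps pmin] := exists_min_foliage s0.
pose c := \sum_(q <- s | foliage q.2 == foliage p.2) q.1.
pose s' := [seq q <- s | foliage q.2 != foliage p.2].
have -> : \sum_(q <- s) q.1 *: lie_of q.2
    = c *: lie_of p.2 + \sum_(q <- s') q.1 *: lie_of q.2.
  rewrite (bigID (fun q => foliage q.2 == foliage p.2)) big_filter; congr (_ + _).
  rewrite scaler_suml big_seq_cond [RHS]big_seq_cond.
  apply: eq_bigr => q /andP[qs /eqP E].
  by rewrite (standard_inj (Ps q qs) (Ps p ps) E).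
move=> M0.
have c0 : c = 0.
  have [_ _ lp] := leads_magnus (Ps p ps).
  have ev (f g : S) w : f + g = 0 -> f w + g w = 0.
    by move=> fg; rewrite -ncsDE fg.
  move: M0; rewrite lie_homD lie_homZ lie_hom_sum => /(ev _ _ (foliage p.2)).
  rewrite ncsZE lp mulr1.
  suff -> : (\sum_(q <- s') magnus (q.1 *: lie_of q.2)) (foliage p.2) = 0.
    by rewrite addr0.
  rewrite big_seq; apply: (big_ind (fun f : S => f (foliage p.2) = 0)) => //.
    by move=> f g f0 g0; rewrite ncsDE f0 g0 addr0.
  move=> q; rewrite mem_filter => /andP[nq qs].
  have [_ lq _] := leads_magnus (Ps q qs).
  by rewrite lie_homZ ncsZE lq ?mulr0 // lt_neqAle eq_sym nq pmin.
move: M0; rewrite c0 scale0r add0r; apply: IH.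
  by move=> q; rewrite mem_filter => /andP[_ /Ps].
rewrite -ltnS (leq_trans _ sn) // size_filter.
rewrite -(count_predC (fun q => foliage q.2 == foliage p.2)).
rewrite -[ltnLHS]add0n ltn_add2r -has_count; apply/hasP; by exists p.
Qed.
End LyndonBasis.

(** * Operations defined by a Lie word in two letters *)

Section BinaryWords.
Context (K : comNzRingType).

Definition pair_of (L : Type) (a b : L) (i : bool) : L := if i then b else a.

Definition word_op (w : free_lie K bool) (L : lieAlgType K) (a b : L) : L :=
  free_lie_lift (pair_of a b) w.

Lemma word_op_hom w (L M : lieAlgType K) (f : lie_hom L M) a b :
  f (word_op w a b) = word_op w (f a) (f b).
Proof.
rewrite /word_op -[LHS]/(lie_comp f (free_lie_lift (pair_of a b)) w).
congr (lie_fun _ w); apply: free_lie_lift_unique => i.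
rewrite -[LHS]/(f (free_lie_lift (pair_of a b) (free_lie_var K i))).
by rewrite free_lie_lift_var; case: i.
Qed.

Lemma lie_hom_word_op (L : lieAlgType K) (f : lie_hom (free_lie K bool) L) w :
  f w = word_op w (f (free_lie_var K false)) (f (free_lie_var K true)).
Proof.
by congr (lie_fun _ w); apply: free_lie_lift_unique => -[].
Qed.

(** Brackets of commuting elements vanish, so only the linear part of the word
    acts. *)
Lemma word_op_comm w : exists p q : K, forall (L : lieAlgType K) (a b : L),
  lieb a b = 0 -> word_op w a b = p *: a + q *: b.
Proof.
elim/free_lie_ind: w => [[]||u v [p [q IH]] [p' [q' IH']]|c u [p [q IH]]
  |u v [p [q IH]] [p' [q' IH']]].
- by exists 0, 1 => L a b _; rewrite /word_op free_lie_lift_var scale0r scale1r add0r.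
- by exists 1, 0 => L a b _; rewrite /word_op free_lie_lift_var scale0r scale1r addr0.
- by exists 0, 0 => L a b _; rewrite /word_op lie_hom0 !scale0r addr0.
- exists (p + p'), (q + q') => L a b ab.
  by rewrite /word_op lie_homD -!/(word_op _ _ _) IH // IH' // !scalerDl addrACA.
- exists (c * p), (c * q) => L a b ab.
  by rewrite /word_op lie_homZ -!/(word_op _ _ _) IH // scalerDr !scalerA.
- exists 0, 0 => L a b ab.
  rewrite /word_op lie_funM -!/(word_op _ _ _) IH // IH' // !scale0r addr0.
  rewrite liebDl !liebDr !(liebZl, liebZr) !liebxx (liebC b a) ab oppr0.
  by rewrite !scaler0 !addr0.
Qed.
End BinaryWords.

(** * Words that define an addition *)

Section AffineHoms.
Context (K : comNzRingType).

Section Inclusion.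
Context (A : algType K).

Definition affine_incl : lie_hom (commutator_lie A) (affine_lie A).
Proof.
exists (fun a : commutator_lie A => ((a : A), 0 : A)) => [c x y|x y].
  by apply: injective_projections => //=; rewrite scaler0 addr0.
by rewrite affine_lieE /= !mul0r subrr.
Defined.

Definition affine_proj : lie_hom (affine_lie A) (commutator_lie A).
Proof. by exists (fun x : affine_lie A => x.1 : A). Defined.

Definition affine_lmul (q : A) : lie_hom (affine_lie A) (affine_lie A).
Proof.
exists (fun x : affine_lie A => (x.1, q * x.2)) => [c x y|x y].
  by apply: injective_projections => //=; rewrite mulrDr scalerAr.
by rewrite !affine_lieE /= mulrBr !mulrA.
Defined.
End Inclusion.

Definition affine_map (A B : algType K) (f : {rmorphism A -> B})
  (f_linear : linear f) :
  lie_hom (affine_lie A) (affine_lie B).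
Proof.
exists (fun x : affine_lie A => (f x.1, f x.2)) => [c x y|x y].
  by apply: injective_projections => /=; rewrite f_linear.
by rewrite !affine_lieE /= !rmorphB !rmorphM.
Defined.
End AffineHoms.

Lemma horner_alg_linear (K : comNzRingType) (A : algType K) (a : A) :
  linear (horner_alg a).
Proof.
move=> c p q; rewrite rmorphD -mul_polyC rmorphM /= horner_algC.
by rewrite -scalerAl mul1r.
Qed.

(** Below, [w] is any word whose operation is a commutative monoid law with
    neutral element 0 in all Lie algebras. *)
Section AdditionWord.
Context (K : idomainType) (w : free_lie K bool).
Hypothesis wA : forall (L : lieAlgType K) (a b c : L),
  word_op w a (word_op w b c) = word_op w (word_op w a b) c.
Hypothesis wC : forall (L : lieAlgType K) (a b : L),
  word_op w a b = word_op w b a.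
Hypothesis w0 : forall (L : lieAlgType K) (a : L), word_op w a 0 = a.

Lemma addition_word_comm (L : lieAlgType K) (a b : L) :
  lieb a b = 0 -> word_op w a b = a + b.
Proof.
have [p [q pqE]] := word_op_comm w => ab.
have := w0 a; rewrite (pqE _ a 0) ?lieb0r // scaler0 addr0 => pa.
have := w0 b; rewrite wC (pqE _ 0 b) ?lieb0l // scaler0 add0r => qb.
by rewrite pqE // pa qb.
Qed.

Local Notation aff a b := ((a, b) : affine_lie _).

Local Notation P := {poly K}.

(** Write w((X, 0), (0, 1)) = (X, g) and w((-X, 0), (X, 1)) = (0, h).  Left
    multiplication of the ideal by g is an endomorphism, so it takes the second
    equation to w((-X, 0), (X, g)) = (0, g h).  By associativity this is also
    w(w((-X, 0), (X, 0)), (0, 1)) = (0, 1).  Hence g is a unit of K[X], thus a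
    constant, and substituting 0 for X shows that this constant is 1. *)
Lemma addition_word_polyX :
  word_op w (aff ('X : {poly K}) 0) (aff 0 1) = aff 'X 1.
Proof.
set u := word_op w _ _.
have u1 : u.1 = 'X :> P.
  by rewrite -[LHS]/(affine_proj _ u) word_op_hom /= w0.
pose v := word_op w (aff (- 'X : P) 0) (aff 'X 1).
have XN : word_op w ((- 'X : P) : commutator_lie _) 'X = 0.
  rewrite addition_word_comm ?addNr // commutator_lieE.
  by rewrite mulNr mulrN subrr.
have v1 : v.1 = 0 :> P.
  by rewrite -[LHS]/(affine_proj _ v) word_op_hom.
have uE : u = affine_lmul u.2 (aff 'X 1) by rewrite /= mulr1 -u1; case: (u).
have v1E : affine_lmul u.2 v = aff 0 1.
  have <- : word_op w (aff (- 'X : P) 0) u = affine_lmul u.2 v.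
    by rewrite uE /v [RHS]word_op_hom /= !mulr0 !mulr1.
  rewrite /u wA.
  have -> : word_op w (aff (- 'X : P) 0) (aff 'X 0) = 0.
    rewrite -[word_op _ _ _]/(word_op w (affine_incl _ (- 'X)) (affine_incl _ 'X)).
    by rewrite -word_op_hom XN lie_hom0.
  by rewrite wC w0.
have gh : u.2 * v.2 = 1 by case: v1E.
have u2 : u.2 = (u.2`_0)%:P.
  have: u.2 \is a GRing.unit by apply/unitrPr; exists v.2.
  by rewrite poly_unitE => /andP[/eqP s _]; apply: size1_polyC; rewrite s.
have : affine_map (@horner_alg_linear K _ (0 : P)) u = aff 0 1.
  rewrite /u word_op_hom /= horner_algX !rmorph0 rmorph1.
  by rewrite -[aff 0 0]/(0 : affine_lie P) wC w0.
case=> _; rewrite u2 horner_algC alg_polyC => u21.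
by rewrite uE u2 u21 /= mulr1.
Qed.

Lemma addition_word_aff (A : algType K) (a : A) :
  word_op w (aff a 0) (aff 0 1) = aff a 1.
Proof.
have := congr1 (affine_map (horner_alg_linear a))
  addition_word_polyX.
by rewrite word_op_hom /= horner_algX rmorph0 rmorph1.
Qed.

(** (b, 1) is itself the sum of (b, 0) and (0, 1) in the sense of [w], so
    associativity brings this down to the previous lemma. *)
Lemma addition_word_fox (A : algType K) (a b : A) :
  word_op w (aff a 0) (aff b 1) = aff (word_op w (a : commutator_lie A) b) 1.
Proof.
rewrite -(addition_word_aff b) wA.
rewrite -[word_op w (aff a 0) (aff b 0)]/(word_op w (affine_incl A a) (affine_incl A b)).
by rewrite -word_op_hom; exact: addition_word_aff.
Qed.
End AdditionWord.

(** Evaluating a Lie word at generic elements with a 1 in the ideal beside the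
    letter [t] computes the part of the word that starts with [t]: the
    derivation rule of the ideal is that of [ncs_der] on series without constant
    term. *)
Section Fox.
Context (K : comNzRingType) (X : eqType).
Local Notation S := (ncseries K X).

Lemma ncs_der_letter (t x : X) : ncs_der t (letter x : S) = (t == x)%:R.
Proof.
apply/funext=> m; rewrite ncs_derE /letter eqseq_cons.
by case: (t == x) => //; rewrite /= mulr1n; case: m.
Qed.

Lemma fox_lift (t : X) (u : free_lie K X) :
  free_lie_lift (L := affine_lie S) (fun x => (letter x, (t == x)%:R)) u
  = (magnus u, ncs_der t (magnus u)).
Proof.
elim/free_lie_ind: u => [x||u v IHu IHv|a u IHu|u v IHu IHv].
- by rewrite free_lie_lift_var magnus_var ncs_der_letter.
- by rewrite !lie_hom0.
- by rewrite !lie_homD IHu IHv.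
- by rewrite !lie_homZ IHu.
- rewrite !lie_funM IHu IHv affine_lie_pairE commutator_lieE; congr (_, _).
  apply/funext=> m; rewrite ncs_derE !ncsDE !ncsNE !ncsM_cons !magnus_nil.
  by rewrite !mul0r !add0r.
Qed.
End Fox.

Section AdditionWordE.
Context (K : idomainType) (w : free_lie K bool).
Hypothesis wA : forall (L : lieAlgType K) (a b c : L),
  word_op w a (word_op w b c) = word_op w (word_op w a b) c.
Hypothesis wC : forall (L : lieAlgType K) (a b : L),
  word_op w a b = word_op w b a.
Hypothesis w0 : forall (L : lieAlgType K) (a : L), word_op w a 0 = a.

Lemma addition_wordE (L : lieAlgType K) (a b : L) : word_op w a b = a + b.
Proof.
pose S := ncseries K bool.
have pE (t : bool) (i : bool) : (letter i, (t == i)%:R) =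
    pair_of (letter false, (t == false)%:R) (letter true, (t == true)%:R) i
    :> affine_lie S by case: i.
have der1 t : ncs_der t (magnus w) = 1.
  have := fox_lift t w; rewrite (funext (pE t)) -/(word_op w _ _).
  case: t => /=.
    by rewrite (addition_word_fox wA wC w0) => -[_ <-].
  by rewrite wC (addition_word_fox wA wC w0) => -[_ <-].
have -> : w = free_lie_var K false + free_lie_var K true.
  apply: magnus_inj; rewrite lie_homD !magnus_var.
  apply/funext=> -[|t m]; first by rewrite magnus_nil ncsDE addr0.
  rewrite -ncs_derE der1 ncsDE /letter !eqseq_cons.
  by case: t; case: m => //=; rewrite ?add0r ?addr0.
by rewrite /word_op lie_homD !free_lie_lift_var.
Qed.
End AdditionWordE.

(** * Words that define a biadditive operation *)

(** The algebra morphism that replaces each letter x by the sum of all y with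
    [tau y = Some x]. *)
Section Substitution.
Context (K : comNzRingType) (X Y : Type) (tau : Y -> option X).

Definition ncs_subst (f : ncseries K X) : ncseries K Y :=
  fun m => if all tau m then f (pmap tau m) else 0.

Lemma ncs_subst_some t x f : tau t = Some x ->
  ncs_der t (ncs_subst f) = ncs_subst (ncs_der x f).
Proof. by move=> tx; apply/funext=> m; rewrite ncs_derE /ncs_subst /= tx. Qed.

Lemma ncs_subst_none t f : tau t = None -> ncs_der t (ncs_subst f) = 0.
Proof. by move=> tN; apply/funext=> m; rewrite ncs_derE /ncs_subst /= tN. Qed.

Lemma ncs_substM f g : ncs_subst (f * g) = ncs_subst f * ncs_subst g.
Proof.
apply/funext=> m; elim: m f => [|t m IH] f; first by [].
rewrite ncsM_cons -[ncs_subst _ _]ncs_derE -[ncs_subst g _]ncs_derE.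
case tE: (tau t) => [x|]; last by rewrite !ncs_subst_none // mul0r mulr0 add0r.
rewrite !(ncs_subst_some _ tE) -IH /ncs_subst; case: (all tau m) => /=.
  by rewrite ncs_derE ncsM_cons.
by rewrite mulr0 addr0.
Qed.

Definition ncs_subst_hom :
  lie_hom (commutator_lie (ncseries K X)) (commutator_lie (ncseries K Y)).
Proof.
exists (ncs_subst : commutator_lie _ -> commutator_lie _) => [c f g|f g].
  apply/funext=> m; rewrite ncsDE ncsZE /ncs_subst; case: (all tau m) => //.
  by rewrite mulr0 addr0.
rewrite !commutator_lieE -!ncs_substM; apply/funext=> m.
rewrite ncsDE ncsNE /ncs_subst; case: (all tau m) => //.
by rewrite subrr.
Defined.
End Substitution.

Section BracketWord.
Context (K : comNzRingType) (w : free_lie K bool).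

Let substE (Y : Type) (tau : Y -> option bool) :
  ncs_subst tau (magnus w) =
  word_op w (ncs_subst_hom K tau (letter false)) (ncs_subst_hom K tau (letter true)).
Proof.
rewrite -word_op_hom -[LHS]/(ncs_subst_hom K tau (magnus w)).
by rewrite lie_hom_word_op !magnus_var.
Qed.

(* The alphabet [option bool] has a new letter [None] beside the two old ones.
   The three substitutions send the letter [b] to the sum of [b] and the new
   letter, to [b], and to the new letter, and fix the other letter. *)
Let merge (b : bool) (i : option bool) := Some (odflt b i).
Let drop_new (i : option bool) := i.
Let rename (b : bool) (i : option bool) : option bool :=
  if i is Some c then (if c == b then None else Some c) else Some b.

(** If [b] occurs at least twice in [m], turn its first occurrence into the new
    letter: the resulting word occurs on the left with the coefficient of [m] and
    on the right not at all.  If [b] does not occur, the identity reads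
    c = c + c. *)
Lemma count_letter_eq1 b m :
  (ncs_subst (merge b) (magnus w) : ncseries K (option bool)) =
    ncs_subst drop_new (magnus w) + ncs_subst (rename b) (magnus w) ->
  magnus w m != 0 -> count_mem b m = 1%N.
Proof.
move=> E nz; have {}E n := congr1 (fun f : ncseries K _ => f n) E.
have mm n : pmap (merge b) n = map (odflt b) n by elim: n => //= i n ->.
have am n : all (merge b) n by apply/allP.
have md n : pmap drop_new (map Some n) = n by elim: n => //= i n ->.
have ad n : all drop_new (map Some n) by rewrite all_map; apply/allP.
have ms n : map (odflt b) (map Some n) = n by rewrite -map_comp map_id.
have [bm|bm] := boolP (b \in m); last first.
  have ar : all (rename b) (map Some m).
    rewrite all_map; apply/allP=> c cm /=.
    by case: eqP => [cb|//]; rewrite cb (negPf bm) in cm.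
  have mr : pmap (rename b) (map Some m) = m.
    elim: (m) bm => //= c n IH; rewrite inE negb_or eq_sym => /andP[/negPf->/=].
    by move=> /IH ->.
  move: nz; have := E (map Some m).
  rewrite ncsDE /ncs_subst am mm ms ad md ar mr => /eqP.
  by rewrite -subr_eq subrr eq_sym => ->.
have [m1 [m2 [mE b1]]] : exists m1 m2, m = m1 ++ b :: m2 /\ b \notin m1.
  move: bm; rewrite -has_pred1 => /split_find[c m1 m2 /eqP-> nh].
  by exists m1, m2; rewrite cat_rcons -has_pred1.
rewrite mE count_cat /= eqxx (count_memPn b1) add0n add1n; congr _.+1.
apply/count_memPn/negP=> b2; case/negP: nz.
have := E (map Some m1 ++ None :: map Some m2).
rewrite ncsDE /ncs_subst am mm map_cat /= !ms -mE.
rewrite [all drop_new _]all_cat /= andbF.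
rewrite [all (rename b) _](_ : _ = false) ?addr0 => [->//|].
apply/negbTE; rewrite all_cat /= negb_and orbC all_map -has_predC; apply/orP; left.
by apply/hasP; exists b => //=; rewrite eqxx.
Qed.

Hypothesis wDl : forall (L : lieAlgType K) (a b c : L),
  word_op w (a + b) c = word_op w a c + word_op w b c.
Hypothesis wDr : forall (L : lieAlgType K) (a b c : L),
  word_op w a (b + c) = word_op w a b + word_op w a c.

Let subst_letter (Y : eqType) (tau : Y -> option bool) c :
  ncs_subst tau (letter c) =
  (fun m => (if m is [:: y] then tau y == Some c else false)%:R) :> ncseries K Y.
Proof.
apply/funext=> -[|y [|z m]]; rewrite /ncs_subst /letter //=.
  by case: (tau y) => [x|] //=; rewrite eqseq_cons andbT.
by case: (tau y) => [?|]; case: (tau z) => [?|]; case: (all _ _) => //=;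
  rewrite eqseq_cons andbF.
Qed.

Lemma bilinear_word_bidegree m : magnus w m != 0 ->
  count_mem false m = 1%N /\ count_mem true m = 1%N.
Proof.
have split_b b : ncs_subst_hom K (merge b) (letter b) =
      ncs_subst_hom K drop_new (letter b) + ncs_subst_hom K (rename b) (letter b).
  apply/funext=> n; rewrite ncsDE /= !subst_letter.
  by case: n b => [|[[]|] []] [] //=; rewrite ?addr0 ?add0r.
have keep b : ncs_subst_hom K drop_new (letter (~~ b)) =
    ncs_subst_hom K (merge b) (letter (~~ b)).
  apply/funext=> n; rewrite /= !subst_letter.
  by case: n b => [|[[]|] []] [].
have keep' b : ncs_subst_hom K (rename b) (letter (~~ b)) =
    ncs_subst_hom K (merge b) (letter (~~ b)).
  apply/funext=> n; rewrite /= !subst_letter.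
  by case: n b => [|[[]|] []] [].
move=> nz; split; apply: count_letter_eq1 nz; rewrite !substE split_b.
- by rewrite wDl (keep false) (keep' false).
- by rewrite wDr (keep true) (keep' true).
Qed.

(** Two-letter words only occur in a Lie element through brackets of its linear
    parts. *)
Lemma magnus_transpose (X : eqType) (u : free_lie K X) x y :
  magnus u [:: x; y] = - magnus u [:: y; x].
Proof.
elim/free_lie_ind: u => [z||u v IHu IHv|a u IHu|u v IHu IHv].
- by rewrite magnus_var /letter !eqseq_cons /= !andbF oppr0.
- by rewrite lie_hom0 ncs0E oppr0.
- by rewrite lie_homD !ncsDE IHu IHv opprD.
- by rewrite lie_homZ !ncsZE IHu mulrN.
- rewrite lie_funM commutator_lieE !ncsDE !ncsNE !ncsM_cons !ncsM_nil.
  rewrite !ncs_derE !magnus_nil !mul0r !mulr0 !add0r !addr0 opprB.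
  by rewrite [magnus v _ * _]mulrC [magnus v [:: y] * _]mulrC.
Qed.

Lemma letterM (X : eqType) (x y : X) (m : seq X) :
  ((letter x : ncseries K X) * letter y) m = (m == [:: x; y])%:R.
Proof.
have x0 : (letter x : ncseries K X) [::] = 0 by [].
have y0 : (letter y : ncseries K X) [::] = 0 by [].
case: m => [|t [|u m]]; first by rewrite ncsM_nil x0 mul0r.
  by rewrite ncsM_cons ncsM_nil x0 y0 mul0r mulr0 addr0 eqseq_cons andbF.
rewrite !ncsM_cons x0 mul0r add0r ncs_derE.
have -> : ncs_der u (ncs_der t (letter x : ncseries K X)) = 0.
  by apply/funext=> n; rewrite !ncs_derE /letter !eqseq_cons andbF.
rewrite mul0r addr0 /letter !eqseq_cons andbT.
by case: (t == x); rewrite ?mul1r ?mul0r.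
Qed.

Lemma bilinear_wordE : exists c : K, forall (L : lieAlgType K) (a b : L),
  word_op w a b = c *: lieb a b.
Proof.
exists (magnus w [:: false; true]) => L a b.
have {1}-> : w = magnus w [:: false; true] *:
    lieb (free_lie_var K false) (free_lie_var K true).
  apply: magnus_inj; apply/funext=> m.
  rewrite lie_homZ lie_funM !magnus_var commutator_lieE ncsZE ncsDE ncsNE !letterM.
  have [->|mft] := eqVneq m [:: false; true]; first by rewrite subr0 mulr1.
  have [->|mtf] := eqVneq m [:: true; false].
    by rewrite magnus_transpose sub0r mulrN1.
  rewrite subrr mulr0; apply/eqP; apply: contraT => /bilinear_word_bidegree.
  by case: m mft mtf => [|[] [|[] [|[] m]]] // _ _ [] //=.
by rewrite /word_op lie_homZ lie_funM !free_lie_lift_var.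
Qed.
End BracketWord.

(** * Automorphisms of categories *)

Lemma existT_inj (A : Type) (P : A -> Type) (p : A) (x y : P p) :
  existT P p x = existT P p y -> x = y.
Proof.
move=> e; have := projT2_eq e.
by rewrite (Prop_irrelevance (projT1_eq e) erefl).
Qed.

Lemma automorphism_faithful (C : category) (G : functor C C) (X Y : C) :
  category_automorphism G -> injective (@fmap _ _ G X Y).
Proof.
move=> [_ /bij_inj Ginj] f g fg; pose P (XY : C * C) := Defs.hom XY.1 XY.2.
apply: (@existT_inj _ P (X, Y)).
by apply: (Ginj (existT P (X, Y) f) (existT P (X, Y) g)); rewrite /farrow /= fg.
Qed.

Lemma automorphism_full (C : category) (G : functor C C) (X Y : C)
  (g : Defs.hom (G X) (G Y)) :
  category_automorphism G -> exists f : Defs.hom X Y, fmap G f = g.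
Proof.
move=> [/bij_inj Oinj [inv _ invK]].
have := invK (existT (fun XY : C * C => Defs.hom XY.1 XY.2) (G X, G Y) g).
case: (inv _) => -[X' Y'] f; rewrite /farrow /= => e.
have := congr1 tag e => -[/Oinj eX /Oinj eY]; subst X' Y'.
by exists f; apply: existT_inj e.
Qed.

(** * Natural operations on free Lie algebras *)

Lemma free_lie_var_neq0 (K : comNzRingType) (X : eqType) (x : X) :
  free_lie_var K x <> 0.
Proof.
move=> /(congr1 magnus); rewrite magnus_var lie_hom0.
move=> /(congr1 (fun f : ncseries K X => f [:: x])) /eqP.
by rewrite /letter eqxx oner_eq0.
Qed.

Lemma free_lie_scalar_inj (K : comNzRingType) (X : eqType) (x : X) (a b : K) :
  a *: free_lie_var K x = b *: free_lie_var K x -> a = b.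
Proof.
move=> /(congr1 magnus); rewrite !lie_homZ magnus_var.
move=> /(congr1 (fun f : ncseries K X => f [:: x])).
by rewrite !ncsZE /letter eqxx !mulr1.
Qed.

Lemma free_lie_rank1 (K : comNzRingType) (X : Type) (x : X)
  (u : free_lie K X) : (forall y, y = x) -> exists c, u = c *: free_lie_var K x.
Proof.
move=> X1; elim/free_lie_ind: u => [y||u v [a ->] [b ->]|c u [a ->]
  |u v [a ->] [b ->]].
- by exists 1; rewrite scale1r (X1 y).
- by exists 0; rewrite scale0r.
- by exists (a + b); rewrite scalerDl.
- by exists (c * a); rewrite scalerA.
- by exists 0; rewrite liebZl liebZr liebxx !scaler0 scale0r.
Qed.

(** The operations live on the algebras F(Y i), where i ranges over an index set
    and every finite subset of X0 is some [Y i].  Taking for Y the identity, or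
    the action of an automorphism on objects, covers both an operation on all
    F(X) and one on all F(phi X). *)
Section NaturalOperations.
Context (K : idomainType) (X0 : choiceType).
Hypothesis X0_infinite : infinite_set [set: X0].
Context (I : Type) (Y : I -> {fset X0}).
Hypothesis Y_surj : forall Z, exists i, Y i = Z.

Lemma fresh_letter (s : seq X0) : exists x, x \notin s.
Proof.
apply: contrapT => /forallNP sA; apply: X0_infinite.
apply: (@sub_finite_set _ _ [set` s]); last exact: finite_seq.
by move=> x _ /=; apply: contrapT => /negP/sA.
Qed.

(** Makes identities in at most three variables pass from the algebras F(Y i) to
    all Lie algebras. *)
Lemma three_generators (L : lieAlgType K) (a b c : L) :
  exists (i : I) (h : lie_hom (free_lie K (Y i)) L) (a' b' c' : free_lie K (Y i)),
    [/\ h a' = a, h b' = b & h c' = c].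
Proof.
have [x _] := fresh_letter [::]; have [y] := fresh_letter [:: x].
have [z] := fresh_letter [:: x; y]; rewrite !inE negb_or => /andP[zx zy] yx.
have [i Yi] := Y_surj [fset x; y; z]%fset.
have xY : x \in Y i by rewrite Yi !inE eqxx.
have yY : y \in Y i by rewrite Yi !inE eqxx orbT.
have zY : z \in Y i by rewrite Yi !inE eqxx !orbT.
pose h := free_lie_lift (fun t : Y i =>
  if val t == x then a else if val t == y then b else c).
exists i, h, (free_lie_var K [` xY]%fset), (free_lie_var K [` yY]%fset),
  (free_lie_var K [` zY]%fset).
by split; rewrite free_lie_lift_var /= ?eqxx ?(negPf yx) ?(negPf zx) ?(negPf zy).
Qed.

Context (op : forall i, free_lie K (Y i) -> free_lie K (Y i) -> free_lie K (Y i)).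
Hypothesis op_natural :
  forall i j (nu : lie_hom (free_lie K (Y i)) (free_lie K (Y j))) a b,
    nu (op a b) = op (nu a) (nu b).

(** Naturality reduces [op] to its value at two free generators. *)
Lemma natural_op_word : exists w : free_lie K bool,
  forall i (a b : free_lie K (Y i)), op a b = word_op w a b.
Proof.
have [i [h [a' [b' [_ [ha hb _]]]]]] :=
  three_generators (free_lie_var K false) (free_lie_var K true) 0.
exists (h (op a' b')) => j a b.
have := op_natural (lie_comp (free_lie_lift (pair_of a b)) h) a' b'.
by rewrite !lie_compE ha hb !free_lie_lift_var.
Qed.

Lemma natural_addition :
  (forall i (a b c : free_lie K (Y i)), op a (op b c) = op (op a b) c) ->
  (forall i (a b : free_lie K (Y i)), op a b = op b a) ->
  (forall i (a : free_lie K (Y i)), op a 0 = a) ->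
  forall i (a b : free_lie K (Y i)), op a b = a + b.
Proof.
have [w opE] := natural_op_word => opA opC op0 i a b; rewrite opE.
apply: addition_wordE => L {}a; [move=> {}b c|move=> {}b|].
- have [j [h [a' [b' [c' [<- <- <-]]]]]] := three_generators a b c.
  by rewrite -!word_op_hom -!opE opA.
- have [j [h [a' [b' [_ [<- <- _]]]]]] := three_generators a b 0.
  by rewrite -!word_op_hom -!opE opC.
- have [j [h [a' [_ [_ [<- _ _]]]]]] := three_generators a 0 0.
  by rewrite -(lie_hom0 h) -!word_op_hom -!opE op0.
Qed.

Lemma natural_bilinear :
  (forall i (a b c : free_lie K (Y i)), op (a + b) c = op a c + op b c) ->
  (forall i (a b c : free_lie K (Y i)), op a (b + c) = op a b + op a c) ->
  exists c : K, forall i (a b : free_lie K (Y i)), op a b = c *: lieb a b.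
Proof.
have [w opE] := natural_op_word => opDl opDr.
have [||c cE] := @bilinear_wordE K w.
- move=> L a b c.
  have [j [h [a' [b' [c' [<- <- <-]]]]]] := three_generators a b c.
  by rewrite -!(lie_homD h, word_op_hom) -!opE opDl lie_homD.
- move=> L a b c.
  have [j [h [a' [b' [c' [<- <- <-]]]]]] := three_generators a b c.
  by rewrite -!(lie_homD h, word_op_hom) -!opE opDr lie_homD.
by exists c => i a b; rewrite opE cE.
Qed.
End NaturalOperations.

(** * Automorphisms of the category of free Lie algebras *)

Section Automorphism.
Context (K : idomainType) (X0 : choiceType).
Hypothesis X0_infinite : infinite_set [set: X0].
Context (phi : functor (free_lie_category K X0) (free_lie_category K X0)).
Hypothesis phi_aut : category_automorphism phi.

Definition phi_map (X Y : {fset X0}) (f : lie_hom (free_lie K X) (free_lie K Y)) :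
  lie_hom (free_lie K (phi X)) (free_lie K (phi Y)) := fmap phi f.

Lemma phi_map_comp (X Y Z : {fset X0}) (g : lie_hom (free_lie K Y) (free_lie K Z))
  (f : lie_hom (free_lie K X) (free_lie K Y)) u :
  phi_map (lie_comp g f) u = phi_map g (phi_map f u).
Proof.
rewrite /phi_map.
rewrite -[lie_comp g f]/(@Defs.comp (free_lie_category K X0) _ _ _ g f).
by rewrite fmap_comp.
Qed.

Lemma phi_map_id (X : {fset X0}) u : phi_map (lie_id (free_lie K X)) u = u.
Proof.
by rewrite /phi_map -[lie_id _]/(@idm (free_lie_category K X0) X) fmap1.
Qed.

Lemma phi_map_inj (X Y : {fset X0}) : injective (@phi_map X Y).
Proof. exact: (@automorphism_faithful (free_lie_category K X0) phi X Y phi_aut). Qed.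

Lemma phi_map_full (X Y : {fset X0}) g : exists f, @phi_map X Y f = g.
Proof.
exact: (@automorphism_full (free_lie_category K X0) phi X Y g phi_aut).
Qed.

Lemma phi_surj (Z : {fset X0}) : exists X : {fset X0}, phi X = Z.
Proof. by case: phi_aut => -[g _ gK] _; exists (g Z). Qed.

Context (x0 : X0).
Definition X1 : {fset X0} := [fset x0]%fset.
Definition x1 : X1 := [` fset11 x0]%fset.
Definition probe (X : {fset X0}) (a : free_lie K X) :
  lie_hom (free_lie K X1) (free_lie K X) := free_lie_lift (fun _ => a).

Lemma X1_unique (y : X1) : y = x1.
Proof. by apply/val_inj/eqP; rewrite -in_fset1; apply: valP. Qed.

Lemma probe_var (X : {fset X0}) (a : free_lie K X) :
  probe a (free_lie_var K x1) = a.
Proof. exact: free_lie_lift_var. Qed.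

Lemma probe_hom (X : {fset X0}) (f : lie_hom (free_lie K X1) (free_lie K X)) :
  f = probe (f (free_lie_var K x1)).
Proof. by apply: free_lie_lift_unique => y; rewrite (X1_unique y). Qed.

(** On two generators, the endomorphisms y1 |-> y1, y |-> 0 and y1 |-> y,
    y |-> 0 do not commute; on none, the identity is the only endomorphism, while
    F(x1) has also the zero one. *)
Lemma phi_X1_rank1 : exists y1 : phi X1, forall y : phi X1, y = y1.
Proof.
have comm (f g : lie_hom (free_lie K (phi X1)) (free_lie K (phi X1))) u :
    f (g u) = g (f u).
  have [f' <-] := phi_map_full f; have [g' <-] := phi_map_full g.
  rewrite -!phi_map_comp; congr (phi_map _ u).
  apply: free_lie_hom_eq => y; rewrite (X1_unique y) !lie_compE.
  have [a fE] := free_lie_rank1 (f' (free_lie_var K x1)) X1_unique.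
  have [b gE] := free_lie_rank1 (g' (free_lie_var K x1)) X1_unique.
  by rewrite fE gE !lie_homZ fE gE !scalerA mulrC.
have [y1 _] : exists y1 : phi X1, True.
  apply: contrapT => /forallNP emp.
  apply: (@free_lie_var_neq0 K _ x1).
  rewrite -{1}[free_lie_var K x1]probe_var.
  rewrite -(@phi_map_inj _ _ (probe 0) (probe (free_lie_var K x1))).
    exact: probe_var.
  by apply: free_lie_hom_eq => y; case: (emp y).
exists y1 => y; apply: contrapT => /eqP yy1.
pose f := free_lie_lift (fun t : phi X1 => if t == y1 then free_lie_var K y1 else 0).
pose g := free_lie_lift (fun t : phi X1 => if t == y1 then free_lie_var K y else 0).
have := comm f g (free_lie_var K y1).
rewrite !free_lie_lift_var eqxx !free_lie_lift_var eqxx (negPf yy1).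
by move/esym/free_lie_var_neq0.
Qed.

Context (y1 : phi X1) (y1_unique : forall y, y = y1).

(** The bijection A -> Hom(F(x1), A) -> Hom(F(y1), phi(A)) -> phi(A), where the
    middle map is [phi_map]. *)
Definition transfer (X : {fset X0}) (a : free_lie K X) : free_lie K (phi X) :=
  phi_map (probe a) (free_lie_var K y1).

Lemma transfer_natural (X Y : {fset X0})
  (nu : lie_hom (free_lie K X) (free_lie K Y)) a :
  phi_map nu (transfer a) = transfer (nu a).
Proof.
rewrite /transfer -phi_map_comp (probe_hom (lie_comp nu (probe a))).
by rewrite lie_compE probe_var.
Qed.

Lemma transfer_inj (X : {fset X0}) : injective (@transfer X).
Proof.
move=> a b ab; rewrite -(probe_var a) -(probe_var b).
congr (lie_fun _ _); apply: phi_map_inj; apply: free_lie_hom_eq => y.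
by rewrite (y1_unique y).
Qed.

Lemma transfer_surj (X : {fset X0}) b : exists a, @transfer X a = b.
Proof.
have [f fE] := phi_map_full (free_lie_lift (fun _ : phi X1 => b)).
exists (f (free_lie_var K x1)).
by rewrite /transfer -probe_hom fE free_lie_lift_var.
Qed.

Definition transfer_inv (X : {fset X0}) b := sval (cid (@transfer_surj X b)).

Lemma transfer_invK (X : {fset X0}) : cancel (@transfer_inv X) (@transfer X).
Proof. by move=> b; apply: (svalP (cid (transfer_surj b))). Qed.

Lemma transferK (X : {fset X0}) : cancel (@transfer X) (@transfer_inv X).
Proof. by move=> a; apply: transfer_inj; rewrite transfer_invK. Qed.

Lemma transfer_inv_natural (X Y : {fset X0})
  (nu : lie_hom (free_lie K X) (free_lie K Y)) b :
  nu (transfer_inv b) = transfer_inv (phi_map nu b).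
Proof.
by apply: transfer_inj; rewrite transfer_invK -transfer_natural transfer_invK.
Qed.

Lemma transfer_var : transfer (free_lie_var K x1) = free_lie_var K y1.
Proof.
rewrite /transfer -[RHS]phi_map_id; congr (lie_fun (phi_map _) _).
by apply/esym/free_lie_lift_unique => y; rewrite (X1_unique y).
Qed.

Lemma transfer_scale_ex (c : K) : exists c' : K,
  transfer (c *: free_lie_var K x1) = c' *: free_lie_var K y1.
Proof. exact: free_lie_rank1. Qed.

Definition twist c := sval (cid (transfer_scale_ex c)).

Lemma transferZ (X : {fset X0}) c (a : free_lie K X) :
  transfer (c *: a) = twist c *: transfer a.
Proof.
rewrite -{1}(probe_var a) -lie_homZ -transfer_natural.
by rewrite (svalP (cid (transfer_scale_ex c))) lie_homZ.
Qed.

Lemma twistP c c' (a := free_lie_var K x1) :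
  transfer (c *: a) = c' *: transfer a -> twist c = c'.
Proof. by rewrite transferZ transfer_var => /free_lie_scalar_inj. Qed.

Lemma twist_inj : injective twist.
Proof.
move=> a b ab; apply: (@free_lie_scalar_inj _ _ x1); apply: transfer_inj.
by rewrite !transferZ ab.
Qed.

Lemma twist_surj c : exists b, twist b = c.
Proof.
have [a aE] := transfer_surj (c *: free_lie_var K y1).
have [b bE] := free_lie_rank1 a X1_unique.
by exists b; apply: twistP; rewrite -bE aE transfer_var.
Qed.

Lemma twist1 : twist 1 = 1.
Proof. by apply: twistP; rewrite !scale1r. Qed.

Lemma twistM : {morph twist : a b / a * b}.
Proof. by move=> a b; apply: twistP; rewrite -scalerA !transferZ scalerA. Qed.

Lemma twist0 : twist 0 = 0.
Proof.
by have [c c0] := twist_surj 0; rewrite -{1}(mul0r c) twistM c0 mulr0.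
Qed.

Lemma transfer0 (X : {fset X0}) : transfer (0 : free_lie K X) = 0.
Proof. by have := @transferZ X 0 0; rewrite twist0 !scale0r. Qed.

(** The addition of phi(X), pulled back to X, is natural and is a commutative
    monoid law. *)
Lemma transferD (X : {fset X0}) (a b : free_lie K X) :
  transfer (a + b) = transfer a + transfer b.
Proof.
rewrite -[RHS]transfer_invK; congr transfer; apply/esym.
have surj_id (Z : {fset X0}) : exists i, id i = Z by exists Z.
apply: (natural_addition X0_infinite surj_id
  (op := fun X (a b : free_lie K X) => transfer_inv (transfer a + transfer b)))
  => [i j nu {}a {}b|i {}a {}b c|i {}a {}b|i {}a].
- by rewrite transfer_inv_natural lie_homD !transfer_natural.
- by rewrite !transfer_invK addrA.
- by rewrite addrC.
- by rewrite transfer0 addr0 transferK.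
Qed.

Lemma transfer_invD (X : {fset X0}) : {morph @transfer_inv X : a b / a + b}.
Proof.
by move=> a b; apply: transfer_inj; rewrite transferD !transfer_invK.
Qed.

Lemma twistD : {morph twist : a b / a + b}.
Proof.
by move=> a b; apply: twistP; rewrite scalerDl transferD !transferZ scalerDl.
Qed.

Lemma transfer_bracket : exists c : K, forall (X : {fset X0}) (a b : free_lie K X),
  transfer (c *: lieb a b) = lieb (transfer a) (transfer b).
Proof.
have surj_id (Z : {fset X0}) : exists i, id i = Z by exists Z.
have [|||c cE] := natural_bilinear X0_infinite surj_id
  (op := fun X (a b : free_lie K X) => transfer_inv (lieb (transfer a) (transfer b))).
- by move=> i j nu a b; rewrite transfer_inv_natural lie_funM !transfer_natural.
- by move=> i a b c; rewrite transferD liebDl transfer_invD.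
- by move=> i a b c; rewrite transferD liebDr transfer_invD.
by exists c => X a b; rewrite -cE transfer_invK.
Qed.

Lemma bracket_transfer : exists c : K, forall (X : {fset X0}) (a b : free_lie K X),
  transfer (lieb a b) = c *: lieb (transfer a) (transfer b).
Proof.
have [|||c cE] := natural_bilinear X0_infinite phi_surj
  (op := fun X (a b : free_lie K (phi X)) =>
    transfer (lieb (transfer_inv a) (transfer_inv b))).
- move=> i j nu a b; have [nu' <-] := phi_map_full nu.
  by rewrite transfer_natural lie_funM !transfer_inv_natural.
- by move=> i a b c; rewrite transfer_invD liebDl transferD.
- by move=> i a b c; rewrite transfer_invD liebDr transferD.
by exists c => X a b; rewrite -cE !transferK.
Qed.

(** With s [a, b] = c [s a, s b] and s (e [a, b]) = [s a, s b], comparison on two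
    free generators, where k [x, y] = [x, y] only for k = 1, gives d(e) c = 1. *)
Lemma bracket_transfer_unit : exists c e : K, e * c = 1 /\
  forall (X : {fset X0}) (a b : free_lie K X),
    transfer (lieb a b) = c *: lieb (transfer a) (transfer b).
Proof.
have [c cE] := bracket_transfer; have [e eE] := transfer_bracket.
exists c, (twist e); split=> //; have [k kE] := twist_surj (twist e * c).
have [y] := fresh_letter X0_infinite [:: x0]; rewrite inE => yx.
pose X : {fset X0} := [fset x0; y]%fset.
have xX : x0 \in X by rewrite !inE eqxx.
have yX : y \in X by rewrite !inE eqxx orbT.
pose a := free_lie_var K [` xX]%fset; pose b := free_lie_var K [` yX]%fset.
have : k *: lieb a b = lieb a b.
  by apply: transfer_inj; rewrite transferZ kE [RHS]cE -eE transferZ scalerA mulrC.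
move=> /(congr1 magnus); rewrite lie_homZ lie_funM !magnus_var commutator_lieE.
move=> /(congr1 (fun f : ncseries K X => f [:: [` xX]%fset; [` yX]%fset])).
rewrite ncsZE ncsDE ncsNE !letterM eqxx eqseq_cons -val_eqE /=.
by rewrite eq_sym (negPf yx) subr0 mulr1 -kE => ->; rewrite twist1.
Qed.

Lemma automorphism_semi_inner : semi_inner phi.
Proof.
have [c [e [ec cE]]] := bracket_transfer_unit.
have twistB : {morph twist : a b / a - b}.
  move=> a b; apply/eqP; rewrite eq_sym subr_eq -twistD.
  by rewrite addrNK.
pose delta : {rmorphism K -> K} := HB.pack twist
  (GRing.isZmodMorphism.Build K K twist twistB)
  (GRing.isMonoidMorphism.Build K K twist (twist1, twistM)).
(* Scaling by c absorbs it: c s [a, b] = c^2 [s a, s b] = [c s a, c s b]. *)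
exists delta, (fun X a => c *: transfer a); split=> [X|X Y nu a] /=; last first.
  by rewrite -[fmap phi nu]/(phi_map nu) lie_homZ transfer_natural.
split=> [|| u v | u v | k u].
- have [t tK] := choice twist_surj.
  by exists t => // k; apply: twist_inj; rewrite tK.
- exists (fun b => transfer_inv (e *: b)) => b.
    by rewrite scalerA ec scale1r transferK.
  by rewrite transfer_invK scalerA mulrC ec scale1r.
- by rewrite transferD scalerDr.
- by rewrite cE liebZl liebZr.
- by rewrite transferZ !scalerA mulrC.
Qed.
End Automorphism.

Theorem theoremC (K : idomainType) (X0 : choiceType)
  (K_R1MF : R1MF_domain K)
  (X0_infinite : infinite_set [set: X0])
  (phi : functor (free_lie_category K X0) (free_lie_category K X0)) :
  category_automorphism phi -> semi_inner phi.
Proof.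
move=> phi_aut; have [x0 _] := fresh_letter X0_infinite [::].
have [y1 y1_unique] := phi_X1_rank1 phi_aut x0.
exact: automorphism_semi_inner y1_unique.
Qed.
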